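(* Let $R$ be a commutative local ring of bounded module type, with maximal ideal $P$. Then: \begin{enumerate} \item $R$ is a valuation ring. \item (a) For every nonzero and nonarchimedean ideal $I$ of $R$, the ring $R/I$ is complete in its ideal topology. (b) If the zero ideal of $R$ is not prime and is nonarchimedean, then $R$ is also complete in its ideal topology. \item $R$ is an almost henselian ring. \item For every nonmaximal prime ideal $J$ of $R$, the localization $R_J$ is almost maximal. \end{enumerate}
   Context: All rings are associative, commutative, with identity. Local means having a unique maximal ideal (no Noetherian hypothesis). A ring $R$ has bounded module type if, for some positive integer $n$, every finitely generated $R$-module is a direct sum of submodules each generated by at most $n$ elements. A valuation ring is a ring (possibly with zero-divisors) whose ideals are totally ordered by inclusion. For an ideal $I$ of a valuation ring $R$ with maximal ideal $P$ and $p\in R$, $(I:p)=\{r\in R\mid rp\in I\}$. The ideal $I$ is archimedean if $(I:p)\neq I$ for every $p\in P$; otherwise it is nonarchimedean. The ideal topology of a valuation ring $S$ is the linear topology in which the family $\mathcal{J}$ of all nonzero ideals of $S$ is a base of neighborhoods of $0$; $S$ is complete in its ideal topology if the canonical homomorphism $S\to\varprojlim_{I\in\mathcal{J}}S/I$ is an isomorphism. A valuation ring $S$ is almost maximal if every family of cosets $\{r_\lambda+I_\lambda\mid\lambda\in\Lambda\}$ ($r_\lambda\in S$, $I_\lambda$ an ideal of $S$) which is totally ordered by inclusion and satisfies $\bigcap_{\lambda\in\Lambda}I_\lambda\neq 0$ has nonempty intersection. A local ring $R$ is almost henselian if every proper factor ring of $R$ (i.e. $R/I$ with $I$ a nonzero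 proper ideal) is a henselian ring. *)

(* Defs.v *)
From HB Require Import structures.
From mathcomp Require Import all_boot all_algebra.
From mathcomp Require Import boolp ring.

Set Implicit Arguments.
Unset Strict Implicit.
Unset Printing Implicit Defensive.

Import GRing.Theory.
Local Open Scope ring_scope.
Local Open Scope quotient_scope.

(* As in ring_quotient, ideals are boolean predicates; classically (boolp)    *)
(* every Prop-valued ideal is of this form.  Unlike [idealr], [ideal] allows  *)
(* the improper ideal.                                                        *)
Definition ideal (R : comNzRingType) (I : {pred R}) : Prop :=
  [/\ 0 \in I, {in I &, forall u v, u + v \in I}
    & forall a, {in I, forall u, a * u \in I}].

Definition nonzero_ideal (R : comNzRingType) (I : {pred R}) : Prop :=
  exists2 a, a \in I & a != 0.

Definition maximal_ideal (R : comNzRingType) (M : {pred R}) : Prop :=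
  [/\ ideal M, 1 \notin M
    & forall I : {pred R}, ideal I -> 1 \notin I -> {subset M <= I} -> I =i M].

Definition local_with (R : comNzRingType) (P : {pred R}) : Prop :=
  maximal_ideal P /\ forall M : {pred R}, maximal_ideal M -> M =i P.

Definition local_ring (R : comNzRingType) : Prop :=
  exists P : {pred R}, local_with P.

Section BoundedModuleType.

Variable R : comNzRingType.

Definition generated_by_at_most (n : nat) (M : lmodType R) (N : {pred M}) :
    Prop :=
  exists k : nat, exists2 g : 'I_k -> M, (k <= n)%N &
    forall x, x \in N <-> exists c : 'I_k -> R, x = \sum_i c i *: g i.

Definition finitely_generated (M : lmodType R) : Prop :=
  exists n, generated_by_at_most n (predT : {pred M}).

(* Internal direct sum of a possibly infinite family of submodules. *)
Definition is_direct_sum (M : lmodType R) (I : eqType)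
    (N : I -> submodClosed M) : Prop :=
  (forall x : M, exists s : seq I, exists2 v : I -> M,
      forall i, v i \in N i & x = \sum_(i <- s) v i) /\
  (forall (s : seq I) (v : I -> M), uniq s -> (forall i, v i \in N i) ->
      \sum_(i <- s) v i = 0 -> {in s, forall i, v i = 0}).

Definition bounded_module_type : Prop :=
  exists2 n : nat, (0 < n)%N &
    forall M : lmodType R, finitely_generated M ->
      exists (I : eqType) (N : I -> submodClosed M),
        is_direct_sum N /\ forall i, generated_by_at_most n (N i).

End BoundedModuleType.

Definition valuation_ring (R : comNzRingType) : Prop :=
  forall I J : {pred R}, ideal I -> ideal J ->
    {subset I <= J} \/ {subset J <= I}.

Definition colon (R : comNzRingType) (I : {pred R}) (p : R) : {pred R} :=
  [pred r | r * p \in I].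

Definition archimedean (R : comNzRingType) (P I : {pred R}) : Prop :=
  forall p, p \in P -> ~ (colon I p =i I).

Definition nonarchimedean (R : comNzRingType) (P I : {pred R}) : Prop :=
  ~ archimedean P I.

Section IdealTopology.

Variable S : comNzRingType.

(* The improper ideal is left out: its factor S / S of the limit is zero. *)
Record nzideal := NzIdeal {
  nzideal_val :> idealr S;
  _ : nonzero_ideal nzideal_val }.

(* The elements of the inverse limit of the S / I among all families. *)
Definition compatible (x : forall I : nzideal, {ideal_quot I}) : Prop :=
  forall I J : nzideal, {subset (I : {pred S}) <= (J : {pred S})} ->
    \pi_{ideal_quot J} (repr (x I)) = x J.

(* Bijectivity of the canonical map from S to the inverse limit. *)
Definition ideal_complete : Prop :=
  forall x : (forall I : nzideal, {ideal_quot I}), compatible x ->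
    exists! a : S, forall I : nzideal, \pi_{ideal_quot I} a = x I.

End IdealTopology.

Definition coset_of_ideal (S : comNzRingType) (r : S) (I : {pred S}) :
    {pred S} :=
  [pred x | x - r \in I].

Definition almost_maximal (S : comNzRingType) : Prop :=
  valuation_ring S /\
  forall (L : Type) (r : L -> S) (I : L -> {pred S}),
    (forall l, ideal (I l)) ->
    (forall l m,
      {subset coset_of_ideal (r l) (I l) <= coset_of_ideal (r m) (I m)} \/
      {subset coset_of_ideal (r m) (I m) <= coset_of_ideal (r l) (I l)}) ->
    (exists2 a : S, a != 0 & forall l, a \in I l) ->
    exists x : S, forall l, x \in coset_of_ideal (r l) (I l).

(* Hensel's lemma: coprime monic factorizations over the residue field lift.  *)
Definition henselian (A : comNzRingType) : Prop :=
  local_ring A /\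
  forall m : idealr A, maximal_ideal m ->
  forall (f : {poly A}) (g0 h0 : {poly {ideal_quot m}}),
    f \is monic -> g0 \is monic -> h0 \is monic ->
    (exists u v : {poly {ideal_quot m}}, u * g0 + v * h0 = 1) ->
    map_poly \pi_{ideal_quot m} f = g0 * h0 ->
    exists g h : {poly A},
      [/\ g \is monic, h \is monic, f = g * h,
          map_poly \pi_{ideal_quot m} g = g0
        & map_poly \pi_{ideal_quot m} h = h0].

Definition almost_henselian (R : comNzRingType) : Prop :=
  local_ring R /\
  forall I : idealr R, nonzero_ideal I -> henselian {ideal_quot I}.

(* MathComp only has the fraction field of a domain, whence the following     *)
(* construction of R_J, as pairs (numerator, denominator) up to the usual     *)
(* equivalence for rings that may have zero-divisors.                         *)
Module Localization.
Section Localization.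

Variables (R : comNzRingType) (J : prime_idealr R).

Record frac := Frac { frac_val : R * R; _ : frac_val.2 \notin J }.

#[export]
HB.instance Definition _ := [isSub for frac_val].
#[export]
HB.instance Definition _ := [Choice of frac by <:].

Definition num (x : frac) : R := (frac_val x).1.
Definition den (x : frac) : R := (frac_val x).2.

Lemma denP (x : frac) : den x \notin J. Proof. exact: valP x. Qed.

Lemma notin1 : 1 \notin J. Proof. by rewrite idealr1. Qed.

Lemma notinM a b : a \notin J -> b \notin J -> a * b \notin J.
Proof. by rewrite prime_idealrM negb_or => -> ->. Qed.

Definition mkfrac (a s : R) (sJ : s \notin J) : frac :=
  @Frac (a, s) sJ.

Definition equiv (x y : frac) : bool :=
  `[< exists2 u, u \notin J & u * (num x * den y - num y * den x) = 0 >].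

Lemma equivP x y :
  reflect (exists2 u, u \notin J & u * num x * den y = u * num y * den x)
          (equiv x y).
Proof.
apply: (iffP (asboolP _)) => -[u uJ e]; exists u => //.
  by apply/eqP; rewrite -subr_eq0 -!mulrA -mulrBr e.
by rewrite mulrBr !mulrA e subrr.
Qed.

Lemma equiv_refl : reflexive equiv.
Proof. by move=> x; apply/equivP; exists 1 => //; exact: notin1. Qed.

Lemma equiv_sym : symmetric equiv.
Proof.
by move=> x y; apply/equivP/equivP => -[u uJ e]; exists u; rewrite // e.
Qed.

Lemma equiv_trans : transitive equiv.
Proof.
move=> y x z /equivP[u uJ exy] /equivP[v vJ eyz]; apply/equivP.
exists (u * v * den y); first by rewrite !notinM ?denP.
transitivity (v * den z * (u * num x * den y)); first by ring.
rewrite exy; transitivity (u * den x * (v * num y * den z)); first by ring.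
by rewrite eyz; ring.
Qed.

Canonical equiv_equiv := EquivRel equiv equiv_refl equiv_sym equiv_trans.

Definition type := {eq_quot equiv}.

#[export]
HB.instance Definition _ : EqQuotient _ equiv type := EqQuotient.on type.
#[export]
HB.instance Definition _ := Choice.on type.

Definition zerof := mkfrac 0 notin1.
Definition onef := mkfrac 1 notin1.
Definition oppf (x : frac) := mkfrac (- num x) (denP x).
Definition addf (x y : frac) :=
  mkfrac (num x * den y + num y * den x) (notinM (denP x) (denP y)).
Definition mulf (x y : frac) :=
  mkfrac (num x * num y) (notinM (denP x) (denP y)).

Definition zero := lift_cst type zerof.
Definition one := lift_cst type onef.
Definition opp := lift_op1 type oppf.
Definition add := lift_op2 type addf.
Definition mul := lift_op2 type mulf.

Canonical pi_zero_morph := PiConst zero.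
Canonical pi_one_morph := PiConst one.

Lemma repr_equiv (x : frac) :
  exists2 u, u \notin J & u * num x * den (repr (\pi_type x)) =
                          u * num (repr (\pi_type x)) * den x.
Proof. by apply/equivP; rewrite -eqmodE reprK. Qed.

Lemma pi_opp : {morph \pi : x / oppf x >-> opp x}.
Proof.
move=> x; unlock opp; apply/eqmodP/equivP; rewrite /num /den /= -/(num _).
have [u uJ e] := repr_equiv x; exists u => //.
by move: e; rewrite /num /den !mulrN !mulNr => ->.
Qed.
Canonical pi_opp_morph := PiMorph1 pi_opp.

Lemma pi_add : {morph \pi : x y / addf x y >-> add x y}.
Proof.
move=> x y; unlock add; apply/eqmodP/equivP.
have [u uJ ex] := repr_equiv x; have [v vJ ey] := repr_equiv y.
exists (u * v); first exact: notinM.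
move: ex ey; set x' := repr (\pi x); set y' := repr (\pi y).
rewrite /addf /num /den /= => ex ey.
transitivity
    (u * (frac_val x).1 * (frac_val x').2 *
       (v * (frac_val y).2 * (frac_val y').2)
     + v * (frac_val y).1 * (frac_val y').2 *
       (u * (frac_val x).2 * (frac_val x').2)); first by ring.
by rewrite ex ey; ring.
Qed.
Canonical pi_add_morph := PiMorph2 pi_add.

Lemma pi_mul : {morph \pi : x y / mulf x y >-> mul x y}.
Proof.
move=> x y; unlock mul; apply/eqmodP/equivP.
have [u uJ ex] := repr_equiv x; have [v vJ ey] := repr_equiv y.
exists (u * v); first exact: notinM.
move: ex ey; set x' := repr (\pi x); set y' := repr (\pi y).
rewrite /mulf /num /den /= => ex ey.
transitivity
    (u * (frac_val x).1 * (frac_val x').2 *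
       (v * (frac_val y).1 * (frac_val y').2)); first by ring.
by rewrite ex ey; ring.
Qed.
Canonical pi_mul_morph := PiMorph2 pi_mul.

Lemma eq_type (x y : frac) :
  num x * den y = num y * den x -> \pi_type x = \pi_type y.
Proof.
move=> e; apply/eqmodP/equivP; exists 1; first exact: notin1.
by rewrite !mul1r.
Qed.

Lemma addA : associative add.
Proof.
elim/quotW=> x; elim/quotW=> y; elim/quotW=> z; rewrite !piE.
by apply: eq_type; rewrite /addf /mulf /oppf /zerof /onef /num /den /=; ring.
Qed.

Lemma addC : commutative add.
Proof.
elim/quotW=> x; elim/quotW=> y; rewrite !piE.
by apply: eq_type; rewrite /addf /mulf /oppf /zerof /onef /num /den /=; ring.
Qed.

Lemma add0 : left_id zero add.
Proof.
elim/quotW=> x; rewrite !piE.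
by apply: eq_type; rewrite /addf /mulf /oppf /zerof /onef /num /den /=; ring.
Qed.

Lemma addN : left_inverse zero opp add.
Proof.
elim/quotW=> x; rewrite !piE.
by apply: eq_type; rewrite /addf /mulf /oppf /zerof /onef /num /den /=; ring.
Qed.

#[export]
HB.instance Definition _ := GRing.isZmodule.Build type addA addC add0 addN.

Lemma mulA : associative mul.
Proof.
elim/quotW=> x; elim/quotW=> y; elim/quotW=> z; rewrite !piE.
by apply: eq_type; rewrite /addf /mulf /oppf /zerof /onef /num /den /=; ring.
Qed.

Lemma mulC : commutative mul.
Proof.
elim/quotW=> x; elim/quotW=> y; rewrite !piE.
by apply: eq_type; rewrite /addf /mulf /oppf /zerof /onef /num /den /=; ring.
Qed.

Lemma mul1 : left_id one mul.
Proof.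
elim/quotW=> x; rewrite !piE.
by apply: eq_type; rewrite /addf /mulf /oppf /zerof /onef /num /den /=; ring.
Qed.

Lemma mulDl : left_distributive mul add.
Proof.
elim/quotW=> x; elim/quotW=> y; elim/quotW=> z; rewrite !piE.
by apply: eq_type; rewrite /addf /mulf /oppf /zerof /onef /num /den /=; ring.
Qed.

Lemma one_neq0 : one != zero.
Proof.
rewrite !piE; apply/negP => /equivP[u uJ].
rewrite /num /den /= !mulr1 mulr0 => u0.
by rewrite u0 idealr0 in uJ.
Qed.

#[export]
HB.instance Definition _ :=
  GRing.Zmodule_isComNzRing.Build type mulA mulC mul1 mulDl one_neq0.

End Localization.

Module Exports. HB.reexport. End Exports.
End Localization.

Export Localization.Exports.

Notation localization := Localization.type.

(* Main.v *)
Require Import Defs.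
From mathcomp Require Import all_boot all_algebra.
From mathcomp Require Import boolp.
From HB Require Import structures.
From mathcomp Require Import classical_sets ring zify.

(** Every part of the theorem comes from one way of refuting bounded module
    type. If each finitely generated module is a direct sum of modules with at
    most n generators, then on any R^m / K the projections onto the summands
    lift to matrices that preserve K, have rank at most n modulo P, and add up
    to 1 modulo K ([lifted_projections]). So there is no K inside P R^m all of
    whose endomorphisms are, on more than n of the generators, triangular
    modulo P with a constant diagonal: a matrix of that kind and of rank at
    most n has diagonal 0, and such matrices do not add up to 1
    ([triangular_endomorphisms_absurd]).

    If a and b do not divide each other, the relations a e_i = b e_(i+1), taken
    modulo a P + b P, form a Kronecker module, whose endomorphisms are scalar
    modulo P. Hence R is a valuation ring ([divides_total_of_bounded]).

    The main step is [limit_exists], the completeness of R / I for I nonzero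
    and nonarchimedean, say (I : p) = I with p in P. Suppose that u is a limit
    of elements of R modulo all ideals strictly larger than I. Then c u makes
    sense modulo b R for suitable c in P and b in I, and R^(n+2) / K is
    generated by x_0, ..., x_n and y, where x_i has annihilator p^(2i) b R and
    c y = sum_i c p^(i+1) u x_i. Since (I : p) = I, rescaling by powers of p
    changes the annihilators but not the precision to which u is seen. The
    different annihilators make endomorphisms triangular on the x_i. Applying
    an endomorphism to the relation for c y gives, in each coordinate x_i, an
    equation of degree 2 in u, with the same leading coefficient up to a power
    of p. As u may well be a root of a quadratic polynomial over R, only the
    linear equations left after eliminating u^2 are of use: unless the diagonal
    is constant modulo P, one of them determines u as an element of R.

    The rest follows from [limit_exists]. If 0 is nonarchimedean and z w = 0
    with z and w nonzero, then z R is isomorphic to R / (0 : z), so it is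
    complete, and it is open in R ([ring_complete]). For Hensel's lemma modulo
    I, Newton's method squares the error of an approximate factorization; the
    intersection of the ideals generated by the errors is then a nonmaximal
    prime ideal containing I, modulo which the approximations have a limit
    ([hensel_factorization]). Finally, a chain of cosets in R_J with nonzero
    breadth ideal pulls back to a Cauchy family of R modulo an ideal on which
    the elements of P outside J act regularly
    ([almost_maximal_localization]). *)

Set Implicit Arguments.
Unset Strict Implicit.
Unset Printing Implicit Defensive.

Import GRing.Theory.
Local Open Scope ring_scope.
Local Open Scope quotient_scope.

(** * Divisibility, maximal ideals and residue fields *)

Definition divides (R : comNzRingType) (a b : R) : Prop := exists r, b = r * a.

Lemma divides_refl (R : comNzRingType) (a : R) : divides a a.
Proof. by exists 1; rewrite mul1r. Qed.

Lemma divides_trans (R : comNzRingType) (a b c : R) :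
  divides a b -> divides b c -> divides a c.
Proof. by move=> [r ->] [s ->]; exists (s * r); rewrite mulrA. Qed.

Lemma divides_mull (R : comNzRingType) (a b c : R) :
  divides a b -> divides a (c * b).
Proof. by move=> [r ->]; exists (c * r); rewrite mulrA. Qed.

Lemma divides_mulr (R : comNzRingType) (a b c : R) :
  divides a b -> divides a (b * c).
Proof. by rewrite mulrC; exact: divides_mull. Qed.

Lemma divides_mul2l (R : comNzRingType) (a b c : R) :
  divides a b -> divides (c * a) (c * b).
Proof. by move=> [r ->]; exists r; rewrite mulrCA. Qed.

Lemma dividesD (R : comNzRingType) (a b c : R) :
  divides a b -> divides a c -> divides a (b + c).
Proof. by move=> [r ->] [s ->]; exists (r + s); rewrite mulrDl. Qed.

Lemma dividesN (R : comNzRingType) (a b : R) : divides a b -> divides a (- b).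
Proof. by move=> [r ->]; exists (- r); rewrite mulNr. Qed.

Lemma dividesB (R : comNzRingType) (a b c : R) :
  divides a b -> divides a c -> divides a (b - c).
Proof. by move=> ab ac; apply: dividesD => //; exact: dividesN. Qed.

Lemma divides0 (R : comNzRingType) (a : R) : divides a 0.
Proof. by exists 0; rewrite mul0r. Qed.

Lemma divides_sum (R : comNzRingType) (I : Type) (s : seq I) (a : R)
    (F : I -> R) :
  (forall i, divides a (F i)) -> divides a (\sum_(i <- s) F i).
Proof.
by move=> aF; elim/big_ind: _ => //; [exact: divides0 | exact: dividesD].
Qed.

Lemma ideal_principal (R : comNzRingType) (a : R) :
  ideal [pred x | `[< divides a x >]].
Proof.
split; first by apply/asboolP; exact: divides0.
  move=> u v /asboolP au /asboolP av; apply/asboolP; exact: dividesD.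
by move=> c u /asboolP au; apply/asboolP; exact: divides_mull.
Qed.

Lemma ideal_divides (R : comNzRingType) (I : {pred R}) (a b : R) :
  ideal I -> divides a b -> a \in I -> b \in I.
Proof. by move=> [_ _ IM] [r ->] /IM; apply. Qed.

Lemma idealB (R : comNzRingType) (I : {pred R}) (a b : R) :
  ideal I -> a \in I -> b \in I -> a - b \in I.
Proof.
by move=> [_ ID IM] aI bI; rewrite ID //; rewrite -mulN1r; exact: IM.
Qed.

Lemma ideal_idealr (R : comNzRingType) (I : idealr R) : ideal I.
Proof.
split; [exact: idealr0 | exact: rpredD |].
by move=> a u; exact: idealMr.
Qed.

(** Zorn's lemma: the union of a chain of ideals avoiding 1 avoids 1. *)
Lemma exists_maximal_ideal (R : comNzRingType) (I : {pred R}) :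
  ideal I -> 1 \notin I ->
  exists2 M : {pred R}, maximal_ideal M & {subset I <= M}.
Proof.
move=> Iid I1.
pose T := {J : R -> bool | [/\ @ideal R J, 1 \notin (J : {pred R})
  & {subset I <= (J : {pred R})}]}.
pose le (J K : T) : bool := `[< {subset sval J <= sval K} >].
have chain (A : set T) : total_on A le -> exists t, forall s, A s -> le s t.
  move=> totA; have [[J0 AJ0]|A0] := pselect (exists J, A J); last first.
    have It : [/\ ideal I, 1 \notin I & {subset I <= I}] by split.
    by exists (exist _ I It) => s As; case: A0; exists s.
  pose U : R -> bool := [pred x | `[< exists2 J, A J & x \in sval J >]].
  have UP x : reflect (exists2 J, A J & x \in sval J) (x \in U).
    exact: asboolP.
  have Ut : [/\ ideal U, 1 \notin U & {subset I <= U}].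
    split; last 2 first.
    - by apply/UP => -[J _]; apply/negP; case: (svalP J).
    - move=> x xI; apply/UP; exists J0 => //.
      by case: (svalP J0) => _ _; exact.
    split; first by apply/UP; exists J0 => //; case: (svalP J0) => -[].
      move=> u v /UP[J AJ uJ] /UP[K AK vK]; apply/UP.
      have [/asboolP JK|/asboolP KJ] := totA _ _ AJ AK.
        exists K => //; have [[_ KD _] _ _] := svalP K.
        by apply: KD => //; exact: JK.
      exists J => //; have [[_ JD _] _ _] := svalP J.
      by apply: JD => //; exact: KJ.
    move=> a u /UP[J AJ uJ]; apply/UP; exists J => //.
    by have [[_ _ JM] _ _] := svalP J; exact: JM.
  exists (exist _ U Ut) => s As; apply/asboolP => x xs /=.
  by apply/UP; exists s.
pose t0 : T := exist _ I (And3 Iid I1 (fun x xI => xI)).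
have [|r s t /asboolP rs /asboolP st|[M [Mid M1 IM]] maxM] :=
    @ZL_preorder T t0 le _ _ chain.
- by move=> t; apply/asboolP.
- by apply/asboolP => x /rs /st.
exists M => //; split=> // J Jid J1 MJ x; apply/idP/idP; last exact: MJ.
have Jt : [/\ ideal J, 1 \notin J & {subset I <= J}].
  by split => // y /IM /MJ.
move: x; have /asboolP := maxM (exist _ J Jt) (asboolT MJ); exact.
Qed.

Lemma proper_ideal_subset (R : comNzRingType) (P I : {pred R}) :
  (forall x, x \notin P -> exists y, y * x = 1) ->
  ideal I -> 1 \notin I -> {subset I <= P}.
Proof.
move=> Pu [_ _ IM] I1 x xI; apply: contraT => /Pu[y e].
by move/negP: I1 => []; rewrite -e; exact: IM.
Qed.

Section Local.

Variables (R : comNzRingType) (P : {pred R}) (hP : local_with P).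

Lemma local_ideal : ideal P. Proof. by case: hP => -[]. Qed.

Lemma local_unit (x : R) : x \notin P -> exists y, y * x = 1.
Proof.
move=> xP; apply: contrapT => xu.
have [||M maxM xM] := @exists_maximal_ideal R [pred y | `[< divides x y >]].
- exact: ideal_principal.
- by apply/asboolP => -[y e]; apply: xu; exists y.
move/negP: xP; apply; rewrite -(hP.2 _ maxM); apply: xM.
by apply/asboolP; exact: divides_refl.
Qed.

(** Nakayama's lemma for principal ideals. *)
Lemma local_cancel (x a : R) : x \in P -> a = x * a -> a = 0.
Proof.
have [[[_ PD _] P1 _] _] := hP.
move=> xP e; have [|y ye] := @local_unit (1 - x).
  by apply/negP => x1P; move/negP: P1; apply; rewrite -(subrK x 1) PD.
by rewrite -[a]mul1r -ye -mulrA mulrBl mul1r -e subrr mulr0.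
Qed.

End Local.

Lemma local_with_nonunits (R : comNzRingType) (P : {pred R}) :
  ideal P -> 1 \notin P -> (forall x, x \notin P -> exists y, y * x = 1) ->
  local_with P.
Proof.
move=> Pid P1 Pu.
have sub := @proper_ideal_subset R P _ Pu.
split.
  by split => // I Iid I1 PI x; apply/idP/idP; [exact: sub | exact: PI].
move=> M [Mid M1 maxM] x; apply/idP/idP; first exact: sub.
by move=> xP; rewrite -(maxM P) //; exact: sub.
Qed.

(** F is K itself, with inverses added to its structure, and the embedding is
    the identity. *)
Lemma field_of_inverses (K : comNzRingType) :
  (forall x : K, x != 0 -> exists y, y * x = 1) ->
  exists (F : fieldType) (f : {rmorphism K -> F}),
    forall x, (f x == 0) = (x == 0).
Proof.
move=> hinv.
have hinv' (x : K) : exists y, if x == 0 then y = x else y * x = 1.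
  by case: eqVneq => [->|/hinv[y e]]; [exists 0 | exists y].
pose inv x := sval (cid (hinv' x)).
have invE (x : K) : x != 0 -> inv x * x = 1.
  by move=> x0; rewrite /inv; case: cid => y /=; rewrite (negPf x0).
have inv0 : inv 0 = 0 by rewrite /inv; case: cid => y /=; rewrite eqxx.
pose F : fieldType := HB.pack K (GRing.ComNzRing_isField.Build K invE inv0).
have idadd : zmod_morphism (idfun : K -> F) by [].
have idmul : monoid_morphism (idfun : K -> F) by [].
pose f : {rmorphism K -> F} := HB.pack (idfun : K -> F)
  (GRing.isZmodMorphism.Build K F idfun idadd)
  (GRing.isMonoidMorphism.Build K F idfun idmul).
by exists F, f.
Qed.

Lemma ideal_quot_eq0 (R : comNzRingType) (I : idealr R) (x : R) :
  (\pi_{ideal_quot I} x == 0) = (x \in I).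
Proof.
transitivity (x == 0 %[mod {ideal_quot I}]); first by rewrite pi_zeror.
by rewrite -Quotient.idealrBE subr0.
Qed.

Lemma residue_ring (R : comNzRingType) (I : {pred R}) :
  ideal I -> 1 \notin I ->
  exists (K : comNzRingType) (f : {rmorphism R -> K}),
    (forall y, exists x, f x = y) /\ forall x, (f x == 0) = (x \in I).
Proof.
move=> [I0 ID IM] I1.
have Icl : idealr_closed I.
  by split => // a u v uI vI; apply: ID => //; exact: IM.
pose J : idealr R := HB.pack (I : R -> bool) (isIdealr.Build R I Icl).
exists {ideal_quot J}, (\pi_{ideal_quot J} : {rmorphism R -> {ideal_quot J}}).
split; first by move=> y; exists (repr y); exact: reprK.
by move=> x; exact: (ideal_quot_eq0 J).
Qed.

Lemma residue_field (R : comNzRingType) (P : {pred R}) :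
  local_with P ->
  exists (F : fieldType) (f : {rmorphism R -> F}),
    forall x, (f x == 0) = (x \in P).
Proof.
move=> hP; have [[Pid P1 _] _] := hP.
have [K [f [fsurj f0]]] := @residue_ring R P Pid P1.
have [|F [g g0]] := @field_of_inverses K.
  move=> y; have [x <-] := fsurj y; rewrite f0 => /(local_unit hP)[z e].
  by exists (f z); rewrite -rmorphM e rmorph1.
exists F, (g \o f : {rmorphism R -> F}) => x /=.
by rewrite g0 f0.
Qed.

(** * Projections of a direct sum decomposition as matrices *)

Lemma quotient_module (R : pzRingType) (V : lmodType R) (K : {pred V}) :
  submod_closed K ->
  exists (M : lmodType R) (f : {linear V -> M}),
    (forall y, exists x, f x = y) /\ forall x, (f x == 0) = (x \in K).
Proof.
move=> [K0 KP].
have KZ a x : x \in K -> a *: x \in K.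
  by move=> xK; rewrite -[_ *: _]addr0 KP.
have Kcl : zmod_closed K.
  by split => // x y xK yK; rewrite addrC -scaleN1r KP.
pose J : zmodClosed V := HB.pack (K : V -> bool) (GRing.isZmodClosed.Build V K Kcl).
pose Q : zmodType := Quotient.quot J.
pose pi : {additive V -> Q} := \pi_(Quotient.quot J).
have piE x y : pi x = pi y <-> x - y \in K.
  by split=> [/eqP|h]; [|apply/eqP]; rewrite -[X in is_true X]Quotient.idealrBE.
pose scale a (x : Q) : Q := pi (a *: repr x).
have scaleE a x : scale a (pi x) = pi (a *: x).
  by apply/piE; rewrite -scalerBr; apply: KZ; apply/piE; exact: reprK.
have piD x y : pi (x + y) = pi x + pi y by exact: raddfD.
have pi_surj y : exists x, pi x = y by exists (repr y); exact: reprK.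
have scA a b x : scale a (scale b x) = scale (a * b) x.
  by have [z <-] := pi_surj x; rewrite !scaleE scalerA.
have sc1 : left_id 1 scale.
  by move=> x; have [z <-] := pi_surj x; rewrite !scaleE scale1r.
have scDr : right_distributive scale +%R.
  move=> a x y; have [z <-] := pi_surj x; have [t <-] := pi_surj y.
  by rewrite !scaleE -!piD !scaleE scalerDr.
have scDl x a b : scale (a + b) x = scale a x + scale b x.
  by have [z <-] := pi_surj x; rewrite !scaleE -!piD scalerDl.
pose M : lmodType R := HB.pack (Q : Type) (GRing.Zmodule.on Q)
  (GRing.Zmodule_isLmodule.Build R Q scA sc1 scDr scDl).
have lin : linear (pi : V -> M) by move=> a x y; rewrite piD -scaleE.
pose f : {linear V -> M} := HB.pack (pi : V -> M)
  (GRing.isLinear.Build R V M *:%R pi lin).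
exists M, f; split; first exact: pi_surj.
move=> x; rewrite -[x in RHS]subr0; apply/eqP/idP => [e|/piE e].
  by apply/piE; rewrite -[LHS]/(f x) e -(linear0 f).
by rewrite -[LHS]/(pi x) e -(linear0 f).
Qed.

Lemma sum_count_mem (V : nmodType) (I : eqType) (s t : seq I) (v : I -> V) :
  uniq s -> {subset t <= s} ->
  \sum_(i <- t) v i = \sum_(i <- s) v i *+ count_mem i t.
Proof.
move=> us; elim: t => [|a t IHt] ts; first by rewrite big_nil big1.
rewrite big_cons IHt => [|i it]; last by apply: ts; rewrite inE it orbT.
rewrite [in RHS](eq_bigr (fun i => v i *+ (a == i) + v i *+ count_mem i t)).
  rewrite big_split /=; congr (_ + _).
  rewrite (bigD1_seq a) ?ts ?mem_head //= eqxx big1 ?addr0 // => i ia.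
  by rewrite eq_sym (negPf ia).
by move=> i _; rewrite -mulrnDr.
Qed.

Lemma direct_sum_components (R : comNzRingType) (M : lmodType R) (I : eqType)
    (N : I -> submodClosed M) (m : nat) (x : 'I_m -> M) :
  is_direct_sum N ->
  exists (s : seq I) (v : I -> 'I_m -> M),
    [/\ uniq s, forall l i, v l i \in N l
      & forall i, x i = \sum_(l <- s) v l i].
Proof.
move=> [spans _].
have /choice[t ht] : forall i, exists t : seq I, exists2 v : I -> M,
    forall l, v l \in N l & x i = \sum_(l <- t) v l by move=> i; exact: spans.
have /choice[v hv] : forall i, exists v : I -> M,
    (forall l, v l \in N l) /\ x i = \sum_(l <- t i) v l.
  by move=> i; have [v] := ht i; exists v.
pose s := undup (flatten [seq t i | i : 'I_m]).
exists s, (fun l i => v i l *+ count_mem l (t i)); split.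
- exact: undup_uniq.
- by move=> l i; rewrite rpredMn //; have [] := hv i.
- move=> i; have [_ ->] := hv i; apply: sum_count_mem; first exact: undup_uniq.
  move=> l lt; rewrite mem_undup; apply/flattenP; exists (t i) => //.
  by apply: map_f; rewrite mem_enum.
Qed.

Definition bounded_by (R : comNzRingType) (n : nat) : Prop :=
  forall M : lmodType R, finitely_generated M ->
    exists (I : eqType) (N : I -> submodClosed M),
      is_direct_sum N /\ forall i, generated_by_at_most n (N i).

(** The matrices lift the projections of R^m / K onto the summands of a direct
    sum decomposition; B lists coordinates of the images of the generators, and
    G lifts generators of a summand. *)
Lemma lifted_projections (R : comNzRingType) (n : nat) :
  bounded_by R n ->
  forall (m : nat) (K : {pred 'rV[R]_m}), submod_closed K ->
  exists Ts : seq 'M[R]_m,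
    [/\ forall T, T \in Ts -> forall v, v \in K -> v *m T \in K,
        forall v, v *m (\sum_(T <- Ts) T) - v \in K
      & forall T, T \in Ts -> exists k, exists2 B : 'M[R]_(m, k),
          (k <= n)%N & exists G : 'M[R]_(k, m),
            forall v, v *m (T - B *m G) \in K].
Proof.
move=> hn m K Kcl.
have [M [f [fsurj f0]]] := quotient_module Kcl.
pose e (i : 'I_m) : 'rV[R]_m := delta_mx 0 i.
have fE (v : 'rV_m) : f v = \sum_i v 0 i *: f (e i).
  rewrite {1}(row_sum_delta v) linear_sum; apply: eq_bigr => i _.
  by rewrite linearZ.
have [I [N [dN gN]]] : exists (I : eqType) (N : I -> submodClosed M),
    is_direct_sum N /\ forall i, generated_by_at_most n (N i).
  apply: hn; exists m, m; exists (fun i => f (e i)) => // x; split=> // _.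
  by have [v <-] := fsurj x; exists (v 0); exact: fE.
have [s [c [us cN cE]]] := @direct_sum_components R M I N m (fun i => f (e i)) dN.
have /choice[lift liftK] : forall x, exists v, f v = x by [].
pose T l : 'M[R]_m := \matrix_i lift (c l i).
have fT l v : f (v *m T l) = \sum_i v 0 i *: c l i.
  rewrite mulmx_sum_row linear_sum; apply: eq_bigr => i _.
  by rewrite linearZ rowK liftK.
exists [seq T l | l <- s]; split.
- move=> _ /mapP[l ls ->] v; rewrite -!f0 fT => /eqP fv0; apply/eqP.
  apply: (dN.2 s (fun l => \sum_i v 0 i *: c l i) us _ _ l ls) => [l0|].
    by apply: rpred_sum => i _; exact: rpredZ.
  rewrite exchange_big /= -[RHS]fv0 fE; apply: eq_bigr => i _.
  by rewrite -scaler_sumr -cE.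
- move=> v; rewrite -f0 linearB big_map mulmx_sumr linear_sum /= subr_eq0.
  rewrite fE; under eq_bigr do rewrite fT.
  rewrite exchange_big; apply/eqP/eq_bigr => i _ /=.
  by rewrite -scaler_sumr -cE.
- move=> _ /mapP[l ls ->]; have [k [g kn gE]] := gN l.
  have /choice[b bE] : forall i, exists b : 'I_k -> R,
      c l i = \sum_j b j *: g j by move=> i; apply/gE.
  exists k; exists (\matrix_(i, j) b i j) => //.
  exists (\matrix_j lift (g j)) => v.
  rewrite mulmxBr -f0 linearB fT mulmxA mulmx_sum_row linear_sum subr_eq0.
  apply/eqP; under eq_bigr do rewrite bE scaler_sumr.
  rewrite exchange_big; apply: eq_bigr => j _ /=.
  rewrite linearZ rowK liftK [(v *m _) 0 j]mxE /= scaler_suml; apply: eq_bigr => i _.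
  by rewrite mxE scalerA.
Qed.

(** The criterion for excluding bounded module type. If the residue matrix of
    every endomorphism of R^m / K is, on s > n of the generators, triangular
    with a constant diagonal, then a projection onto a summand generated by n
    elements has a residue matrix of rank at most n < s, so that its diagonal
    is 0; but these projections add up to the identity. *)
Lemma triangular_endomorphisms_absurd (R : comNzRingType) (P : {pred R})
    (hP : local_with P) (n : nat) :
  bounded_by R n ->
  forall (m s : nat) (K : {pred 'rV[R]_m}) (h : 'I_s.+1 -> 'I_m),
  (n <= s)%N -> submod_closed K ->
  (forall v, v \in K -> forall i, v 0 i \in P) ->
  (forall T : 'M[R]_m, (forall v, v \in K -> v *m T \in K) ->
     (forall i j : 'I_s.+1, (i < j)%N -> T (h i) (h j) \in P) /\
     (forall i, T (h i) (h i) - T (h ord0) (h ord0) \in P)) ->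
  False.
Proof.
move=> hn m s K h ns Kcl KP hT.
have [Ts [TK TS TB]] := lifted_projections hn Kcl.
have [F [f f0]] := residue_field hP.
have rowP (A : 'M[R]_m) : (forall v, v *m A \in K) -> map_mx f A = 0.
  move=> AK; apply/matrixP => i j; rewrite !mxE; apply/eqP; rewrite f0.
  by have := KP _ (AK (delta_mx 0 i)) j; rewrite -rowE mxE.
have diag0 T : T \in Ts -> f (T (h ord0) (h ord0)) = 0.
  move=> TTs; have [k [B kn [G /rowP]]] := TB T TTs.
  rewrite map_mxB => /eqP; rewrite subr_eq0 => /eqP fTE.
  have [tri dia] := hT T (TK T TTs).
  pose A := mxsub h h (map_mx f T).
  have trigA : is_trig_mx A.
    by apply/is_trig_mxP => i j ij; rewrite !mxE; apply/eqP; rewrite f0 tri.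
  have : \det A = 0.
    apply/eqP; apply/negPn/negP; rewrite -unitfE => uA.
    have : \rank A = s.+1 by apply: mxrank_unit; rewrite unitmxE.
    rewrite /A fTE map_mxM.
    have -> : mxsub h h (map_mx f B *m map_mx f G) =
              rowsub h (map_mx f B) *m colsub h (map_mx f G).
      by apply/matrixP => i j; rewrite !mxE; apply: eq_bigr => l _; rewrite !mxE.
    by move=> rk; have := mulmx_max_rank (rowsub h (map_mx f B)) (colsub h (map_mx f G));
       rewrite rk leqNgt ltnS (leq_trans kn ns).
  rewrite det_trig // (eq_bigr (fun=> f (T (h ord0) (h ord0)))) => [|i _].
    rewrite prodr_const => /eqP; rewrite expf_eq0 => /andP[_ /eqP] //.
  by rewrite !mxE; apply/eqP; rewrite -subr_eq0 -rmorphB f0 dia.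
have := rowP ((\sum_(T <- Ts) T) - 1%:M).
move/(_ (fun v => _)) => e.
have {e} : map_mx f (\sum_(T <- Ts) T - 1%:M) = 0.
  by apply: e => v; rewrite mulmxBr mulmx1; exact: TS.
move/matrixP/(_ (h ord0) (h ord0)).
rewrite !mxE eqxx summxE rmorphB rmorph_sum /= rmorph1.
rewrite big_seq big1 => [|T /diag0 //].
by move/eqP; rewrite sub0r oppr_eq0 oner_eq0.
Qed.

(** * Comparability of elements *)

(** The matrices T preserving the Kronecker relations below are constant along
    diagonals modulo P, and vanish there in the first column below the corner
    and in the last column above the corner. *)
Lemma divides_total_of_bounded (R : comNzRingType) (P : {pred R})
    (hP : local_with P) :
  bounded_module_type R -> forall a b : R, divides a b \/ divides b a.
Proof.
move=> [n _ hn] a b; apply: contrapT => /not_orP[nab nba].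
have [F [f f0]] := residue_field hP.
have f0P x : f x = 0 <-> x \in P by rewrite -f0; split=> /eqP.
have indep x y : x * a + y * b = 0 -> f x = 0 /\ f y = 0.
  move=> e; split; apply/f0P; apply: contraT => /(local_unit hP)[z ze].
    case: nba; exists (- z * y); rewrite -[LHS]mul1r -ze.
    transitivity (z * (x * a + y * b) + - z * y * b); first by ring.
    by rewrite e mulr0 add0r.
  case: nab; exists (- z * x); rewrite -[LHS]mul1r -ze.
  transitivity (z * (x * a + y * b) + - z * x * a); first by ring.
  by rewrite e mulr0 add0r.
have aP : f a = 0.
  apply/f0P; apply: contraT => /(local_unit hP)[z ze]; case: nab.
  by exists (b * z); rewrite -mulrA ze mulr1.
have bP : f b = 0.
  apply/f0P; apply: contraT => /(local_unit hP)[z ze]; case: nba.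
  by exists (a * z); rewrite -mulrA ze mulr1.
(* The relations a e_i = b e_(i+1) generate, together with a P + b P in each
   coordinate; c (i+1) is the coefficient of the i-th relation. *)
pose inK (v : 'rV[R]_n.+1) := exists2 c : nat -> R, c 0%N = 0 /\ c n.+1 = 0 &
  forall j : 'I_n.+1, exists q1 q2, [/\ f q1 = 0, f q2 = 0 &
    v 0 j = c j.+1 * a - c j * b + (q1 * a + q2 * b)].
pose K : {pred 'rV[R]_n.+1} := [pred v | `[< inK v >]].
have KE v : v \in K <-> inK v by split=> /asboolP.
have Kcl : submod_closed K.
  split.
    apply/KE; exists (fun=> 0) => // j; exists 0, 0.
    by rewrite rmorph0 mxE; split=> //; ring.
  move=> x v w /KE[c [c0 cn] cE] /KE[d [d0 dn] dE]; apply/KE.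
  exists (fun j => x * c j + d j) => [|j].
    by rewrite c0 cn d0 dn mulr0 addr0.
  have [q1 [q2 [fq1 fq2 e]]] := cE j; have [r1 [r2 [fr1 fr2 e']]] := dE j.
  exists (x * q1 + r1), (x * q2 + r2).
  rewrite !rmorphD !rmorphM /= fq1 fq2 fr1 fr2 !mxE e e'.
  by split; ring.
have KP v : v \in K -> forall i, v 0 i \in P.
  move=> /KE[c _ cE] j; have [q1 [q2 [_ _ ->]]] := cE j.
  by apply/f0P; rewrite !(rmorphD, rmorphN, rmorphM) /= aP bP; ring.
have genK i : (i < n)%N ->
    a *: delta_mx 0 (inord i) - b *: delta_mx 0 (inord i.+1) \in K.
  move=> ilt; apply/KE; exists (fun j => (j == i.+1)%:R) => [|j].
    by rewrite /= eqSS gtn_eqF.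
  exists 0, 0; rewrite rmorph0; split=> //.
  rewrite !mxE /= -!val_eqE /= !inordK ?ltnS // 1?ltnW // eqSS.
  by ring.
apply: (@triangular_endomorphisms_absurd R P hP n hn n.+1 n K id) => // T TK.
pose t i j := f (T (inord i) (inord j)).
have step i : (i < n)%N ->
  [/\ t i.+1 0%N = 0, t i n = 0 &
      forall j, (j < n)%N -> t i.+1 j.+1 = t i j].
  move=> ilt; have /KE[c [c0 cn] cE] := TK _ (genK i ilt).
  have tE j : (j < n.+1)%N -> t i j = f (c j.+1) /\ t i.+1 j = f (c j).
    move=> jlt; have [q1 [q2 [fq1 fq2]]] := cE (inord j).
    rewrite mulmxBl -!scalemxAl -!rowE !mxE inordK // => e.
    have [|] := indep (T (inord i) (inord j) - c j.+1 - q1)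
                      (- (T (inord i.+1) (inord j) - c j + q2)).
      apply/eqP; rewrite -subr_eq0 subr0; apply/eqP.
      transitivity (a * T (inord i) (inord j) - b * T (inord i.+1) (inord j)
        - (c j.+1 * a - c j * b + (q1 * a + q2 * b))); first by ring.
      by rewrite e subrr.
    rewrite !(rmorphB, rmorphD, rmorphN) /= fq1 fq2 subr0 addr0.
    by rewrite /t => /eqP; rewrite subr_eq0 => /eqP -> /eqP; rewrite oppr_eq0 subr_eq0 => /eqP.
  split.
  - by have [//|_ ->] := tE 0%N; rewrite c0 rmorph0.
  - by have [//|-> _] := tE n; rewrite cn rmorph0.
  - move=> j jlt; have [|-> _] := tE j; first exact: ltnW.
    by have [|_ ->] := tE j.+1.
have tE (i j : 'I_n.+1) : f (T i j) = t i j by rewrite /t !inord_val.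
split=> [i j ij|i]; apply/f0P.
  rewrite tE; have : (j <= n)%N by rewrite -ltnS.
  (* Entries above the diagonal are pushed along it into the last column. *)
  move: ij; move: (nat_of_ord i) (nat_of_ord j) => {}i {}j ij jn.
  have [d dE] : exists d, d = (n - j)%N by exists (n - j)%N.
  elim: d i j ij jn dE => [|d IHd] i j ij jn dE.
    have -> : j = n by apply/eqP; rewrite eqn_leq jn /= -subn_eq0 -dE.
    by have [|_ ->] := step i; first exact: leq_trans ij jn.
  have jn' : (j < n)%N by rewrite -subn_gt0 -dE.
  have [|_ _ <- //] := step i; first exact: leq_trans ij jn.
  by apply: IHd => //; rewrite subnS -dE.
rewrite rmorphB tE [f (T ord0 _)]tE /=.
have : (i <= n)%N by rewrite -ltnS.
elim: (nat_of_ord i) => [|k IHk] kn; first by rewrite subrr.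
by have [//|_ _ ->//] := step k; apply: IHk; exact: ltnW.
Qed.

Lemma valuation_of_total (S : comNzRingType) :
  (forall a b : S, divides a b \/ divides b a) -> valuation_ring S.
Proof.
move=> total I J Iid Jid; have [IJ|/existsNP[a]] := pselect {subset I <= J}.
  by left.
move=> /not_implyP[aI /negP aJ]; right=> b bJ.
have [/ideal_divides|/ideal_divides] := total a b; first exact.
by move=> /(_ _ Jid bJ); rewrite (negPf aJ).
Qed.

(** * Limits modulo a nonarchimedean ideal *)

Section Limits.

Variables (R : comNzRingType) (P : {pred R}) (hP : local_with P).
Hypothesis hR : bounded_module_type R.

Variables (I : {pred R}) (p : R) (u : R -> R).
Hypotheses (Iid : ideal I) (I1 : 1 \notin I) (pP : p \in P).
Hypothesis Ip : forall x, x * p \in I -> x \in I.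
Hypothesis uC : forall j k, j \notin I -> k \notin I -> divides j k ->
  divides j (u j - u k).

Let total := divides_total_of_bounded hP hR.

Lemma pow_notin x k : x \notin I -> x * p ^+ k \notin I.
Proof.
move=> xI; elim: k => [|k IHk]; first by rewrite mulr1.
by apply: contra IHk; rewrite exprSr mulrA; exact: Ip.
Qed.

Lemma divides_of_notin j x : j \notin I -> x \in I -> divides j x.
Proof.
move=> jI xI; have [//|/(ideal_divides Iid)] := total j x.
by move/(_ xI); rewrite (negPf jI).
Qed.

Section Module.

Variables (n : nat) (b : R).
Hypotheses (b0 : p ^+ n.*2 * b != 0) (bI : b \in I).

Lemma divides_last i : (i <= n)%N -> divides (p ^+ i.*2 * b) (p ^+ n.*2 * b).
Proof.
move=> le_in; exists (p ^+ (n.*2 - i.*2)).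
by rewrite mulrA -exprD subnK // leq_double.
Qed.

(** Otherwise r divides p^k, and p^(i+k) b = 0. *)
Lemma pow_annihilator i k r : (i + k <= n.*2)%N ->
  p ^+ i * b * r = 0 -> divides (p ^+ k) r.
Proof.
move=> le e; have [//|[q pk]] := total (p ^+ k) r.
case/eqP: b0; transitivity (p ^+ (n.*2 - (i + k)) * q * (p ^+ i * b * r)).
  by rewrite -{1}(subnK le) !exprD pk; ring.
by rewrite e mulr0.
Qed.

Let y : 'I_n.+2 := ord0.
Let x (i : 'I_n.+1) : 'I_n.+2 := lift ord0 i.

(** The module has generators x i, with annihilator p^(2i) b R, and y, with
    c y = sum_i c p^(i+1) u (x i) for all c such that c u is defined modulo
    p^(2n) b R, the smallest of these annihilators. Here v stands for a relation
    and j for an element modulo which u has to be known. *)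
Definition relation_at (v : 'rV[R]_n.+2) (j : R) :=
  divides (p ^+ n.*2 * b) (v 0 y * j) /\ forall i : 'I_n.+1,
    divides (p ^+ i.*2 * b) (v 0 (x i) + v 0 y * p ^+ i.+1 * u j).

Definition relations : {pred 'rV[R]_n.+2} :=
  [pred v | `[< exists2 j, j \notin I & relation_at v j >]].

Lemma relationsP v :
  reflect (exists2 j, j \notin I & relation_at v j) (v \in relations).
Proof. exact: asboolP. Qed.

Lemma divides_change j k c i : j \notin I -> k \notin I -> divides j k ->
  (i <= n)%N -> divides (p ^+ n.*2 * b) (c * j) ->
  divides (p ^+ i.*2 * b) (c * (u j - u k)).
Proof.
move=> jI kI jk le_in cj; apply: divides_trans (divides_last le_in) _.
by apply: divides_trans cj _; apply: divides_mul2l; exact: uC.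
Qed.

Lemma relation_deepen v j k : j \notin I -> k \notin I -> divides j k ->
  relation_at v j -> relation_at v k.
Proof.
move=> jI kI jk [yj xj]; split=> [|i].
  by apply: divides_trans yj _; exact: divides_mul2l.
have -> : v 0 (x i) + v 0 y * p ^+ i.+1 * u k =
  v 0 (x i) + v 0 y * p ^+ i.+1 * u j - v 0 y * (u j - u k) * p ^+ i.+1 by ring.
apply: dividesB; first exact: xj.
by apply: divides_mulr; apply: divides_change => //; rewrite -ltnS.
Qed.

Lemma relation_common j k : j \notin I -> k \notin I ->
  exists l, [/\ l \notin I, divides j l & divides k l].
Proof.
move=> jI kI; have [jk|kj] := total j k; [exists k | exists j];
  by split=> //; exact: divides_refl.
Qed.

Lemma relations_submod : submod_closed relations.
Proof.
split.
  apply/relationsP; exists 1 => //; split=> [|i]; rewrite !mxE !mul0r ?addr0;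
    exact: divides0.
move=> a v w /relationsP[j jI vj] /relationsP[k kI wk]; apply/relationsP.
have [l [lI jl kl]] := relation_common jI kI; exists l => //.
have [yv xv] := relation_deepen jI lI jl vj.
have [yw xw] := relation_deepen kI lI kl wk.
split=> [|i]; rewrite !mxE.
  rewrite mulrDl -mulrA; apply: dividesD => //; exact: divides_mull.
have -> : a * v 0 (x i) + w 0 (x i) + (a * v 0 y + w 0 y) * p ^+ i.+1 * u l =
  a * (v 0 (x i) + v 0 y * p ^+ i.+1 * u l) +
  (w 0 (x i) + w 0 y * p ^+ i.+1 * u l) by ring.
by apply: dividesD => //; exact: divides_mull.
Qed.

Lemma relations_residue v : v \in relations -> forall i, v 0 i \in P.
Proof.
have Pid := local_ideal hP; have [P0 PD PM] := Pid.
have IP := proper_ideal_subset (local_unit hP) Iid I1.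
case/relationsP=> j jI [yj xj].
have yP : v 0 y \in P.
  apply: contraT => /(local_unit hP)[z e]; move/negP: jI; case.
  have : z * (v 0 y * j) \in I.
    have [_ _ IM] := Iid; apply: (IM); apply: ideal_divides yj _ => //.
    exact: IM.
  by rewrite mulrA e mul1r.
move=> i; case: (unliftP ord0 i) => [k ->|-> //].
rewrite -[v 0 _](addrK (v 0 y * p ^+ k.+1 * u j)); apply: idealB => //.
  apply: ideal_divides (xj k) _ => //; apply: IP.
  by have [_ _ IM] := Iid; exact: IM.
by rewrite -mulrA mulrC; exact: PM.
Qed.

Section Endomorphism.

Variable T : 'M[R]_n.+2.
Hypothesis TK : forall v, v \in relations -> v *m T \in relations.

(** The image under T of the relation p^(2i) b (x i) = 0. *)
Lemma endo_upper (i k : 'I_n.+1) : (i < k)%N ->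
  exists w r, T (x i) (x k) = p ^+ k.+1 * w + p ^+ (k.*2 - i.*2) * r.
Proof.
move=> ik; pose a := p ^+ i.*2 * b.
have /TK/relationsP[j jI [_ /(_ k)]] : a *: delta_mx 0 (x i) \in relations.
  apply/relationsP; exists 1 => //; split=> [|l].
    by rewrite !mxE /= mulr0 mul0r; exact: divides0.
  rewrite !mxE /= mulr0 !mul0r addr0 (inj_eq lift_inj).
  case: eqVneq => [->|_]; last by rewrite mulr0; exact: divides0.
  by rewrite mulr1; exact: divides_refl.
rewrite -scalemxAl -rowE !mxE => -[r e].
have [||w we] := @pow_annihilator i.*2 (k.*2 - i.*2)
  (T (x i) (x k) + T (x i) y * p ^+ k.+1 * u j - r * p ^+ (k.*2 - i.*2)).
- by rewrite subnKC ?leq_double; [rewrite -ltnS | exact: ltnW].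
- have -> : p ^+ i.*2 * b * (T (x i) (x k) + T (x i) y * p ^+ k.+1 * u j -
      r * p ^+ (k.*2 - i.*2)) =
    (a * T (x i) (x k) + a * T (x i) y * p ^+ k.+1 * u j) -
      r * (p ^+ i.*2 * p ^+ (k.*2 - i.*2) * b) by rewrite /a; ring.
  by rewrite -exprD subnKC ?leq_double 1?ltnW // e subrr.
- exists (- (T (x i) y * u j)), (w + r).
  rewrite -[LHS](addrK (T (x i) y * p ^+ k.+1 * u j - r * p ^+ (k.*2 - i.*2))).
  by rewrite addrA we; ring.
Qed.

(** The exponents i+1 of u and 2i of the annihilators are chosen for this:
    after scaling the matrix is diagonal modulo P. *)
Lemma endo_offdiagonal (i k : 'I_n.+1) : i != k ->
  divides (p ^+ k.+2) (p ^+ i.+1 * T (x i) (x k)).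
Proof.
rewrite -val_eqE /= neq_ltn => /orP[ik|ki]; last first.
  by exists (p ^+ (i.+1 - k.+2) * T (x i) (x k)); rewrite mulrAC -exprD subnK.
have [w [r ->]] := endo_upper ik.
rewrite mulrDr; apply: dividesD; rewrite mulrA -exprD; apply: divides_mulr.
  by exists (p ^+ i); rewrite -exprD; rewrite addSnnS.
exists (p ^+ (k - i.+1)); rewrite -exprD; congr (_ ^+ _).
by rewrite -!muln2 -mulnBl; move: ik; clear; lia.
Qed.

Lemma endo_triangular (i k : 'I_n.+1) : (i < k)%N -> T (x i) (x k) \in P.
Proof.
move=> ik; have [_ PD PM] := local_ideal hP.
have [w [r ->]] := endo_upper ik.
rewrite exprS -mulrA [p * _]mulrC; apply: PD; first exact: PM.
have -> : (k.*2 - i.*2 = (k.*2 - i.*2).-1.+1)%N.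
  by rewrite prednK // subn_gt0 ltn_double.
by rewrite exprS -mulrA [p * _]mulrC PM.
Qed.

Let f (k : 'I_n.+1) (z : R) :=
  T y (x k) - z * (\sum_i p ^+ (i : 'I_n.+1).+1 * T (x i) (x k)) +
  (T y y - z * (\sum_i p ^+ (i : 'I_n.+1).+1 * T (x i) y)) * p ^+ k.+1 * z.

(** The image under T of the relation for c y, read in the coordinate x k. *)
Lemma endo_quadratic j c (k : 'I_n.+1) : j \notin I -> divides (p ^+ n.*2 * b) (c * j) ->
  divides (p ^+ k.*2 * b) (c * f k (u j)).
Proof.
move=> jI cj.
pose v : 'rV[R]_n.+2 :=
  \row_l (if unlift ord0 l is Some i then - c * p ^+ i.+1 * u j else c).
have vy : v 0 y = c by rewrite mxE unlift_none.
have vx i : v 0 (x i) = - c * p ^+ i.+1 * u j by rewrite mxE liftK.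
have /TK/relationsP[j' j'I vj'] : v \in relations.
  apply/relationsP; exists j => //; rewrite /relation_at vy; split=> // i.
  by rewrite vx !mulNr addNr; exact: divides0.
have [l [lI jl j'l]] := relation_common jI j'I.
have [_ /(_ k) vl] := relation_deepen j'I lI j'l vj'.
have vT m : (v *m T) 0 m =
    c * (T y m - u j * \sum_i p ^+ (i : 'I_n.+1).+1 * T (x i) m).
  rewrite mxE big_ord_recl -/y vy mulrBr mulrCA [_ * (c * _)]mulrCA.
  rewrite !mulr_sumr -sumrN; congr (_ + _); apply: eq_bigr => i _.
  by rewrite vx; ring.
pose Y := T y y - u j * \sum_i p ^+ (i : 'I_n.+1).+1 * T (x i) y.
have -> : c * f k (u j) = (v *m T) 0 (x k) + (v *m T) 0 y * p ^+ k.+1 * u l +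
    c * (u j - u l) * (Y * p ^+ k.+1).
  by rewrite !vT /f /Y; ring.
apply: dividesD vl _; apply: divides_mulr.
by apply: divides_change => //; rewrite -ltnS.
Qed.

Lemma scaled_column_sum (k : 'I_n.+1) :
  exists w, \sum_i p ^+ (i : 'I_n.+1).+1 * T (x i) (x k) =
    p ^+ k.+1 * (T (x k) (x k) + p * w).
Proof.
have [w we] : divides (p ^+ k.+2)
    (\sum_(i | i != k) p ^+ (i : 'I_n.+1).+1 * T (x i) (x k)).
  elim/big_ind: _ => [||i ik]; [exact: divides0 | by move=> *; exact: dividesD |].
  exact: endo_offdiagonal.
exists w; rewrite (bigD1 k) //= we mulrDr; congr (_ + _).
by rewrite [p ^+ k.+2]exprSr; ring.
Qed.

(** Eliminating u^2 between two of the quadratic relations leaves a linear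
    equation for u, solvable unless the diagonal is constant modulo P. *)
Lemma limit_of_endo (k : 'I_n.+1) : T (x k) (x k) - T (x ord0) (x ord0) \notin P ->
  exists a, forall h, h \notin I -> divides h (a - u h).
Proof.
move=> dP; have [P0 PD PM] := local_ideal hP.
have [w0 w0E] := scaled_column_sum ord0; have [wk wkE] := scaled_column_sum k.
pose eps := T (x ord0) (x ord0) - T (x k) (x k) + p * (w0 - wk).
have [e eE] : exists e, e * eps = 1.
  apply: local_unit hP _ _; apply: contra dP => epsP.
  have -> : T (x k) (x k) - T (x ord0) (x ord0) = (w0 - wk) * p - eps.
    by rewrite /eps; ring.
  by apply: (idealB (local_ideal hP)) => //; exact: PM.
pose beta := T y (x k) - p ^+ k * T y (x ord0).
have fE z : f k z - p ^+ k * f ord0 z = beta + p ^+ k.+1 * eps * z.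
  by rewrite /f w0E wkE /beta /eps exprS /=; ring.
have lin j c : j \notin I -> divides (p ^+ n.*2 * b) (c * j) ->
    divides b (c * (beta + p ^+ k.+1 * eps * u j)).
  move=> jI cj; rewrite -fE mulrBr; apply: dividesB.
    by apply: divides_trans (endo_quadratic k jI cj); exists (p ^+ k.*2).
  rewrite mulrCA; apply: divides_mull.
  by apply: divides_trans (endo_quadratic ord0 jI cj); exists 1; rewrite mul1r.
(* With c j = p^(2n) b, the linear equation times c only holds modulo b; the
   extra factor p^(2n) in j makes up for the difference. *)
have approx h : h \notin I ->
    divides (p ^+ k.+1 * h) (beta + p ^+ k.+1 * eps * u h).
  move=> hI; pose M := (n.*2 + k.+1)%N; pose j := h * p ^+ M.
  have jI : j \notin I by exact: pow_notin.
  have [c cj] : divides j (p ^+ n.*2 * b).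
    by apply: divides_of_notin => //; case: Iid => _ _; apply.
  have [|q qE] := @lin j c jI; first by rewrite -cj; exact: divides_refl.
  set X := beta + p ^+ k.+1 * eps * u j in qE.
  have hX : divides (p ^+ k.+1 * h) X.
    have [//|[r rE]] := total (p ^+ k.+1 * h) X.
    have [rP|/(local_unit hP)[r' r'E]] := boolP (r \in P); last first.
      by exists r'; rewrite rE mulrA r'E mul1r.
    case/eqP: b0; apply: (local_cancel hP (PM q _ rP)).
    transitivity (c * p ^+ n.*2 * (p ^+ k.+1 * h)).
      by rewrite cj /j /M exprD; ring.
    rewrite rE; transitivity (p ^+ n.*2 * r * (c * X)); first by ring.
    by rewrite qE; ring.
  have -> : beta + p ^+ k.+1 * eps * u h =
      X + eps * (p ^+ k.+1 * (u h - u j)) by rewrite /X; ring.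
  apply: dividesD => //; apply: divides_mull; apply: divides_mul2l.
  by apply: uC => //; exists (p ^+ M); rewrite mulrC.
have [b' b'E] : divides (p ^+ k.+1) beta.
  have := approx 1 I1; rewrite mulr1 => -[r rE].
  exists (r - eps * u 1); rewrite mulrBl -rE; ring.
exists (- e * b') => h hI; have [r rE] := approx h hI.
have : divides h (b' + eps * u h - r * h).
  apply: divides_of_notin => //; apply: contraT => /(pow_notin k.+1).
  have -> : (b' + eps * u h - r * h) * p ^+ k.+1 = 0.
    transitivity (b' * p ^+ k.+1 + p ^+ k.+1 * eps * u h - r * (p ^+ k.+1 * h)).
      by ring.
    by rewrite -b'E rE subrr.
  by case: Iid => ->.
move=> [s sE]; exists (- e * (s + r)).
transitivity (- e * (b' + eps * u h - r * h + r * h)); last by rewrite sE; ring.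
transitivity (- e * b' - e * eps * u h); last by ring.
by rewrite eE mul1r.
Qed.

End Endomorphism.

End Module.

(** This is completeness of R / I in its ideal topology, on representatives:
    the nonzero principal ideals of R / I are generated by the j outside I, and
    form a base of neighborhoods of 0. If there is no limit, the module above
    contradicts bounded module type. *)
Lemma limit_exists : nonzero_ideal I ->
  exists a, forall h, h \notin I -> divides h (a - u h).
Proof.
move=> [b0 b0I b0N]; apply: contrapT => nolim.
have [n _ hn] := hR.
have [b bE] : divides (p ^+ n.*2) b0.
  by apply: divides_of_notin => //; rewrite -[p ^+ _]mul1r; exact: pow_notin.
have bI : b \in I.
  by apply: contraT => /(pow_notin n.*2); rewrite -bE b0I.
have bN : p ^+ n.*2 * b != 0 by rewrite mulrC -bE.
apply: (@triangular_endomorphisms_absurd R P hP n hn n.+2 n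
  (relations (n := n) b) (fun i => lift ord0 i) (leqnn n)).
- exact: relations_submod.
- exact: relations_residue.
- move=> T TK; split=> [i j|i]; first exact: (endo_triangular bN TK).
  by apply: contraT => /(limit_of_endo bN bI TK) /nolim.
Qed.

End Limits.

(** * Completeness in the ideal topology *)

Lemma principal_nzideal (S : comNzRingType) (h : S) :
  h != 0 -> ~ divides h 1 ->
  exists J : nzideal S, forall y, y \in (J : {pred S}) <-> divides h y.
Proof.
move=> h0 h1; have [D0 DD DM] := ideal_principal h.
pose D : {pred S} := [pred y | `[< divides h y >]].
have Dcl : idealr_closed D.
  split=> //; first by apply/asboolP.
  by move=> a v w vD wD; apply: DD => //; exact: DM.
pose J : idealr S := HB.pack (D : S -> bool) (isIdealr.Build S D Dcl).
have Jnz : nonzero_ideal J.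
  by exists h => //; apply/asboolP; exact: divides_refl.
by exists (NzIdeal Jnz) => y; split=> /asboolP.
Qed.

(** It is enough to consider the principal ideals, which are cofinal. The
    limit is unique because p d R does not contain d unless d = 0. *)
Lemma ideal_complete_of_limits (S : comNzRingType) (p : S) :
  (forall r a : S, a = r * p * a -> a = 0) ->
  (forall a, a * p = 0 -> a = 0) ->
  (forall u : S -> S,
     (forall j k : S, j != 0 -> k != 0 -> divides j k -> divides j (u j - u k)) ->
     exists a, forall h : S, h != 0 -> divides h (a - u h)) ->
  ideal_complete S.
Proof.
move=> prad preg lim x xC.
have xE (J I : nzideal S) : {subset (J : {pred S}) <= (I : {pred S})} ->
    forall a, a - repr (x J) \in (J : {pred S}) -> \pi_{ideal_quot I} a = x I.
  move=> JI a /JI; rewrite Quotient.idealrBE => /eqP ->; exact: xC.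
have xE' (J I : nzideal S) : {subset (J : {pred S}) <= (I : {pred S})} ->
    repr (x I) - repr (x J) \in (I : {pred S}).
  move=> JI; rewrite Quotient.idealrBE; apply/eqP.
  by rewrite reprK; apply/esym/xC.
have /choice[v vE] : forall h : S, exists b : S, h != 0 -> ~ divides h 1 ->
    exists J : nzideal S, (forall y, y \in (J : {pred S}) <-> divides h y) /\
      b = repr (x J).
  move=> h.
  have [[h0 h1]|nh] := pselect (h != 0 /\ ~ divides h 1).
    by have [J JE] := principal_nzideal h0 h1; exists (repr (x J)); exists J.
  by exists 0 => h0 h1; case: nh.
have [j k j0 k0 jk|a aE] := lim v.
  have [[r rE]|j1] := pselect (divides j 1).
    by exists ((v j - v k) * r); rewrite -mulrA -rE mulr1.
  have k1 : ~ divides k 1 by move=> /(divides_trans jk).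
  have [J [JE ->]] := vE j j0 j1; have [K [KE ->]] := vE k k0 k1.
  by apply/JE/xE' => y /KE /(divides_trans jk) /JE.
have aP (I : nzideal S) : \pi_{ideal_quot I} a = x I.
  have [h hI h0] : nonzero_ideal I by case: I.
  have h1 : ~ divides h 1.
    by move=> [r /esym rE]; have := idealMr r hI; rewrite rE idealr1.
  have [J [JE vh]] := vE h h0 h1.
  apply: (xE J); last by rewrite -vh; apply/JE/aE.
  by move=> y /JE[r ->]; exact: idealMr.
exists a; split=> // b bE.
apply/eqP; rewrite -subr_eq0; apply/negPn/negP => d0; set d := a - b in d0.
have pd0 : p * d != 0 by apply: contra d0; rewrite mulrC => /eqP/preg ->.
have p1 : ~ divides (p * d) 1.
  move=> [r rE]; move: (oner_neq0 S); rewrite (prad (r * d) 1) ?eqxx //.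
  by rewrite {1}rE; ring.
have [J JE] := principal_nzideal pd0 p1.
have : d \in (J : {pred S}).
  by rewrite Quotient.idealrBE aP bE.
move=> /JE[r rE]; move/eqP: d0; apply; apply: (prad r).
by rewrite -mulrA.
Qed.

Lemma nonarchimedeanP (R : comNzRingType) (P I : {pred R}) :
  nonarchimedean P I ->
  exists2 p, p \in P & forall x, (x * p \in I) = (x \in I).
Proof.
move=> na; apply: contrapT => np; apply: na => p pP pI; apply: np.
by exists p => // x; exact: pI.
Qed.

Lemma quotient_complete (R : comNzRingType) (P : {pred R})
    (hP : local_with P) (hR : bounded_module_type R) (I : idealr R) :
  nonzero_ideal I -> nonarchimedean P I -> ideal_complete {ideal_quot I}.
Proof.
move=> Inz /nonarchimedeanP[p pP Ip].
pose q : {rmorphism R -> {ideal_quot I}} := \pi_{ideal_quot I}.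
have q0 x : q x = 0 <-> x \in I by rewrite -(ideal_quot_eq0 I); split=> /eqP.
have qsurj y : exists x, q x = y by exists (repr y); exact: reprK.
have [_ _ PM] := local_ideal hP.
apply: (@ideal_complete_of_limits _ (q p)).
- move=> y b; have [r <-] := qsurj y; have [a <-] := qsurj b => e.
  apply/q0; have : a - r * p * a \in I.
    by apply/q0; rewrite rmorphB !rmorphM /= -e subrr.
  have [|z zE] := @local_unit R P hP (1 - r * p).
    apply/negP => rpP; have [[_ P1 _] _] := hP; move/negP: P1; apply.
    have [_ PD _] := local_ideal hP.
    by rewrite -(subrK (r * p) 1); apply: PD => //; exact: PM.
  move=> /(idealMr z); congr (_ \in I).
  by rewrite -[RHS]mul1r -zE; ring.
- move=> y; have [a <-] := qsurj y => e; apply/q0; rewrite -Ip; apply/q0.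
  by rewrite rmorphM.
- move=> u uC; pose v h := repr (u (q h)).
  have qv h : q (v h) = u (q h) by exact: reprK.
  have [||h|a aE] := @limit_exists R P hP hR I p v (ideal_idealr I) _ pP _ _ Inz.
  + by rewrite idealr1.
  + by move=> h; rewrite Ip.
  + move=> k hI kI [r kE].
    have [|||s sE] := uC (q h) (q k).
    * by apply/eqP => /q0; apply/negP.
    * by apply/eqP => /q0; apply/negP.
    * by exists (q r); rewrite -rmorphM kE.
    have [t tE] := qsurj s.
    have : v h - v k - t * h \in I.
      by apply/q0; rewrite !rmorphB rmorphM /= !qv sE tE subrr.
    move/(divides_of_notin hP hR (ideal_idealr I) hI) => [w wE].
    by exists (w + t); rewrite mulrDl -wE subrK.
  + exists (q a) => y y0; have [h hE] := qsurj y.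
    have [|r rE] := aE h; first by apply/negP => /q0 h0; rewrite -hE h0 eqxx in y0.
    by exists (q r); rewrite -hE -qv -rmorphB rE rmorphM.
Qed.

(** If z w = 0 with z and w nonzero, then z R is isomorphic to R / (0 : z),
    which is complete, and z R is open; so R is complete. *)
Lemma ring_complete (R : comNzRingType) (P : {pred R})
    (hP : local_with P) (hR : bounded_module_type R) :
  ~ prime_idealr_closed (pred1 (0 : R)) ->
  nonarchimedean P (pred1 (0 : R)) -> ideal_complete R.
Proof.
move=> zd /nonarchimedeanP[p pP p0].
have total := divides_total_of_bounded hP hR.
have [z [w [z0 w0 zw]]] : exists z w : R, [/\ z != 0, w != 0 & z * w = 0].
  apply: contrapT => nzd; apply: zd => z w; rewrite !inE => /eqP zw.
  apply: contraT => /norP[z0 w0]; case: nzd; exists z, w; split=> //.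
pose I : {pred R} := [pred x | x * z == 0].
have IE x : (x \in I) = (x * z == 0) by [].
have Iid : ideal I.
  split; first by rewrite IE mul0r.
    by move=> a b; rewrite !IE => /eqP az /eqP bz; rewrite mulrDl az bz addr0.
  by move=> a b; rewrite !IE => /eqP bz; rewrite -mulrA bz mulr0.
have Inz : nonzero_ideal I by exists w => //; rewrite IE mulrC zw.
have I1 : 1 \notin I by rewrite IE mul1r.
have Ip x : x * p \in I -> x \in I.
  by rewrite !IE mulrAC; have := p0 (x * z); rewrite !inE => ->.
apply: (@ideal_complete_of_limits _ p) => [r a e|a e|u uC].
- by apply: (local_cancel hP _ e); have [_ _ PM] := local_ideal hP; exact: PM.
- by apply/eqP; have := p0 a; rewrite !inE e eqxx.
have /choice[v vE] : forall h, exists b, h \notin I -> u (h * z) - u z = b * z.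
  move=> h.
  have [hI|hI] := boolP (h \in I); first by exists 0.
  have [|r rE] := uC z (h * z) z0 hI; first by exists h.
  by exists (- r) => _; rewrite mulNr -rE opprB.
have [h k hI kI hk|a aE] := limit_exists hP hR Iid I1 pP Ip _ (u := v) Inz.
  have [r kE] := hk; have [|s sE] := uC (h * z) (k * z) hI kI.
    by exists r; rewrite kE mulrA.
  have : v h - v k - s * h \in I.
    rewrite IE !mulrBl -!vE // -mulrA -sE; apply/eqP; ring.
  move/(divides_of_notin hP hR Iid hI) => [t tE].
  by exists (t + s); rewrite mulrDl -tE subrK.
exists (u z + a * z) => h h0; have [[k hE]|hz] := total z h.
  have kI : k \notin I by rewrite IE -hE.
  have [r rE] := aE k kI; exists r.
  transitivity ((a - v k) * z); first by rewrite mulrBl -vE // hE; ring.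
  by rewrite rE hE mulrA.
have -> : u z + a * z - u h = a * z - (u h - u z) by ring.
by apply: dividesB; [exact: divides_mull | exact: uC].
Qed.

(** * Localizations at nonmaximal primes *)

Section Localization.

Variables (R : comNzRingType) (J : prime_idealr R).

Lemma localization_map : exists f : {rmorphism R -> localization J},
  (forall s, s \notin J -> exists t, t * f s = 1) /\
  forall q, exists a s, s \notin J /\ f s * q = f a.
Proof.
pose f (a : R) : localization J :=
  \pi_(localization J) (Localization.mkfrac a (Localization.notin1 J)).
have f1 : f 1 = 1 by rewrite -[RHS]/(Localization.one J); unlock Localization.one.
have fB : zmod_morphism f.
  move=> a b; rewrite -[RHS]/(Localization.add (f a) (Localization.opp (f b))).
  rewrite -Localization.pi_opp -Localization.pi_add.
  apply: Localization.eq_type.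
  rewrite /Localization.addf /Localization.oppf /Localization.mulf.
  by rewrite /Localization.num /Localization.den /=; ring.
have fM : monoid_morphism f.
  split=> //.
  move=> a b; rewrite -[RHS]/(Localization.mul (f a) (f b)) -Localization.pi_mul.
  apply: Localization.eq_type.
  rewrite /Localization.addf /Localization.oppf /Localization.mulf.
  by rewrite /Localization.num /Localization.den /=; ring.
pose g : {rmorphism R -> localization J} := HB.pack f
  (GRing.isZmodMorphism.Build R (localization J) f fB)
  (GRing.isMonoidMorphism.Build R (localization J) f fM).
exists g; split.
- move=> s sJ; exists (\pi_(localization J) (Localization.mkfrac 1 sJ)).
  rewrite -f1 -[LHS]/(Localization.mul _ (f s)) -Localization.pi_mul.
  apply: Localization.eq_type.
  rewrite /Localization.addf /Localization.oppf /Localization.mulf.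
  by rewrite /Localization.num /Localization.den /=; ring.
- elim/quotW=> -[[a s] /= sJ]; exists a, s; split=> //.
  rewrite -[LHS]/(Localization.mul (f s) _) -Localization.pi_mul.
  apply: Localization.eq_type.
  rewrite /Localization.addf /Localization.oppf /Localization.mulf.
  by rewrite /Localization.num /Localization.den /=; ring.
Qed.

Lemma total_localization : (forall a b : R, divides a b \/ divides b a) ->
  forall a b : localization J, divides a b \/ divides b a.
Proof.
move=> total a b; have [f [funit fsurj]] := localization_map.
have [a' [s [/funit[s' s's] aE]]] := fsurj a.
have [b' [t [/funit[t' t't] bE]]] := fsurj b.
have [[r rE]|[r rE]] := total a' b'; [left | right].
  exists (t' * f r * f s); rewrite -[LHS]mul1r -t't -!mulrA bE aE -rmorphM.
  by rewrite rE.
exists (s' * f r * f t); rewrite -[LHS]mul1r -s's -!mulrA bE aE -rmorphM.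
by rewrite rE.
Qed.

End Localization.

(** An ideal of R_J pulls back to an ideal of R on which every element outside
    J acts regularly. So a chain of cosets in R_J with nonzero breadth ideal
    pulls back to a Cauchy family of R modulo a nonarchimedean ideal. *)
Lemma almost_maximal_localization (R : comNzRingType) (P : {pred R})
    (hP : local_with P) (hR : bounded_module_type R) (J : prime_idealr R) :
  ~ maximal_ideal J -> almost_maximal (localization J).
Proof.
move=> Jnm; have total := divides_total_of_bounded hP hR.
split; first by apply: valuation_of_total; exact: total_localization.
have [p pP pJ] : exists2 p, p \in P & p \notin J.
  apply: contrapT => PJ; apply: Jnm; split; first exact: ideal_idealr.
    by rewrite idealr1.
  have PsubJ : {subset P <= J}.
    by move=> x xP; apply: contraT => xJ; case: PJ; exists x.
  have sub (I : {pred R}) : ideal I -> 1 \notin I -> {subset I <= J}.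
    by move=> Iid I1 x /(proper_ideal_subset (local_unit hP) Iid I1)/PsubJ.
  by move=> I Iid I1 JI x; apply/idP/idP; [exact: sub | exact: JI].
have [f [funit fsurj]] := localization_map J.
move=> L r I Iid chain [a0 a0N a0I].
(* If every ideal of the family is the whole ring, any point will do. *)
have [[l0 l01]|allT] := pselect (exists l, 1 \notin I l); last first.
  exists 0 => l; have [_ _ IM] := Iid l.
  rewrite inE -[_ - _]mulr1; apply: IM.
  by apply: contraT => l1; case: allT; exists l.
have IB l x y : x \in I l -> y \in I l -> x - y \in I l by exact: idealB.
have Idvd l x y : divides x y -> x \in I l -> y \in I l by exact: ideal_divides.
have cmp l m : (r l - r m \in I m /\ {subset I l <= I m}) \/
               (r m - r l \in I l /\ {subset I m <= I l}).
  have sub k k' : {subset coset_of_ideal (r k) (I k) <= coset_of_ideal (r k') (I k')} ->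
      r k - r k' \in I k' /\ {subset I k <= I k'}.
    move=> kk'; have [I0 _ _] := Iid k.
    have rk : r k - r k' \in I k' by apply: kk'; rewrite inE subrr.
    split=> // x xI; have : r k + x - r k' \in I k'.
      by apply: kk'; rewrite inE addrAC subrr add0r.
    have {2}-> : x = r k + x - r k' - (r k - r k') by ring.
    by move=> /IB; apply.
  by have [/sub|/sub] := chain l m; [left | right].
have [b0 [b0N b0I]] : exists b, b != 0 /\ forall l, f b \in I l.
  have [b [s [/funit[t ts] bE]]] := fsurj a0.
  exists b; split=> [|l]; last by rewrite -bE; have [_ _ IM] := Iid l; exact: IM.
  apply: contra a0N => /eqP b0; rewrite b0 rmorph0 in bE.
  by rewrite -[a0]mul1r -ts -mulrA bE mulr0.
(* A smallest coset, if there is one, is contained in all the others; the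
   limit obtained below would only lie in the cosets that are not smallest. *)
have [[l1 l1min]|nomin] := pselect
    (exists l, forall x, f x \in I l -> forall m, f x \in I m).
  exists (r l1) => m; rewrite inE; have [[]//|[rI _]] := cmp l1 m.
  have [_ _ IM] := Iid m.
  have sub x : x \in I l1 -> x \in I m.
    have [b [s [/funit[t ts] bE]]] := fsurj x => xI.
    rewrite -[x]mul1r -ts -mulrA bE; apply/IM/l1min; rewrite -bE.
    by have [_ _ IM1] := Iid l1; exact: IM1.
  by rewrite -opprB -mulN1r; apply/IM/sub.
(* Translated by r l0, all the representatives can be taken in R, because the
   maximal ideal of R_J comes from J. *)
have /choice[c cE] : forall l, exists c, r l - r l0 - f c \in I l.
  move=> l; have [I0 _ IM] := Iid l.
  have [[rI _]|[rI _]] := cmp l l0; last first.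
    by exists 0; rewrite rmorph0 subr0 -opprB -mulN1r IM.
  have [b [s [sJ bE]]] := fsurj (r l - r l0); have [t ts] := funit s sJ.
  have bJ : b \in J.
    apply: contraT => /funit[w wE]; move/negP: l01 => [].
    by rewrite -wE -bE mulrA; have [_ _ ->] := Iid l0.
  have [[c cE]|[c cE]] := total s b; last first.
    by move: sJ; rewrite cE idealMr.
  exists c; rewrite -[r l - r l0]mul1r -ts -mulrA bE cE rmorphM.
  by rewrite mulrCA ts mulr1 subrr.
pose B : {pred R} := [pred x | `[< forall l, f x \in I l >]].
have BP x : reflect (forall l, f x \in I l) (x \in B) by exact: asboolP.
have notB x : x \notin B -> exists l, f x \notin I l.
  move=> xB; apply: contrapT => allI; move/BP: xB; apply=> l.
  by apply: contraT => xl; case: allI; exists l.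
have Bid : ideal B.
  split; first by apply/BP => l; rewrite rmorph0; case: (Iid l).
    move=> x y /BP xB /BP yB; apply/BP => l; rewrite rmorphD.
    by have [_ ID _] := Iid l; exact: ID.
  move=> x y /BP yB; apply/BP => l; rewrite rmorphM.
  by have [_ _ IM] := Iid l; exact: IM.
have B1 : 1 \notin B.
  by apply/BP => /(_ l0); rewrite rmorph1; apply/negP.
have Bp x : x * p \in B -> x \in B.
  move=> /BP xpB; apply/BP => l; have [t tp] := funit p pJ.
  rewrite -[f x]mulr1 -tp mulrCA -rmorphM.
  by have [_ _ IM] := Iid l; exact: IM.
have Bnz : nonzero_ideal B by exists b0 => //; apply/BP.
have fdvd h y l : f h \notin I l -> f y \in I l -> divides h y.
  move=> hI yI; have [//|[z zE]] := total h y.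
  by move: hI; rewrite zE rmorphM; have [_ _ ->] := Iid l.
have cB l m : exists k, [/\ k = l \/ k = m, {subset I l <= I k},
    {subset I m <= I k} & f (c l - c m) \in I k].
  have [_ ID _] := Iid l; have [_ ID' _] := Iid m.
  have e : f (c l - c m) = (r l - r m) - (r l - r l0 - f (c l)) +
      (r m - r l0 - f (c m)) by rewrite rmorphB; ring.
  have [[rI lm]|[rI ml]] := cmp l m.
    exists m; split=> //; first by right.
    by rewrite e; apply: ID' => //; apply: IB => //; apply: lm.
  exists l; split=> //; first by left.
  rewrite e; apply: ID => //; last exact: ml.
  by apply: IB => //; have [_ _ IM] := Iid l; rewrite -opprB -mulN1r IM.
have /choice[k kE] : forall h, exists l, h \notin B -> f h \notin I l.
  move=> h; have [hB|/notB[l hl]] := boolP (h \in B); first by exists l0.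
  by exists l.
pose u h := c (k h).
have [h h' hB h'B hh'|a aE] := limit_exists hP hR Bid B1 pP Bp _ (u := u) Bnz.
  have [m [mE _ _ cm]] := cB (k h) (k h'); apply: fdvd cm.
  case: mE => ->; first exact: kE.
  apply: contra (kE h' h'B); apply: Idvd; have [w ->] := hh'.
  by exists (f w); rewrite rmorphM.
exists (r l0 + f a) => l; rewrite inE.
have [h [hl hB]] : exists h, f h \in I l /\ h \notin B.
  apply: contrapT => nh; apply: nomin; exists l => x xl; apply/BP.
  by apply: contraT => xB; case: nh; exists x.
have au : f (a - u h) \in I l.
  apply: (Idvd l (f h)) => //; have [w ->] := aE h hB.
  by exists (f w); rewrite rmorphM.
have [m [mE _ _ cm]] := cB (k h) l.
have kl : {subset I (k h) <= I l}.
  by have [[] //|[_ lk]] := cmp (k h) l; move: (kE h hB); rewrite lk.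
have cl : f (c (k h) - c l) \in I l by case: mE cm => -> // /kl.
have [_ ID _] := Iid l.
have -> : r l0 + f a - r l = f (a - u h) + (f (c (k h) - c l) - (r l - r l0 - f (c l))).
  by rewrite /u !rmorphB; ring.
by apply: ID => //; exact: IB.
Qed.

(** * Factorizations of polynomials *)

Section Coefficients.

Variable R : comNzRingType.
Implicit Types (d : R) (p q : {poly R}).

Definition divides_coefs d p : Prop := forall i, divides d p`_i.

Lemma divides_coefsP d p :
  divides_coefs d p <-> exists2 q, p = d *: q & (size q <= size p)%N.
Proof.
split=> [/choice[c cE]|[q -> _] i]; last by rewrite coefZ; exists q`_i; rewrite mulrC.
exists (\poly_(i < size p) c i); last exact: size_poly.
apply/polyP => i; rewrite coefZ coef_poly; case: ltnP => ip.
  by rewrite cE mulrC.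
by rewrite mulr0 nth_default.
Qed.

Lemma divides_coefs_trans d e p :
  divides d e -> divides_coefs e p -> divides_coefs d p.
Proof. by move=> de ep i; exact: divides_trans de (ep i). Qed.

Lemma divides_coefsD d p q :
  divides_coefs d p -> divides_coefs d q -> divides_coefs d (p + q).
Proof. by move=> dp dq i; rewrite coefD; exact: dividesD. Qed.

Lemma divides_coefsN d p : divides_coefs d p -> divides_coefs d (- p).
Proof. by move=> dp i; rewrite coefN; exact: dividesN. Qed.

Lemma divides_coefsM d p q : divides_coefs d p -> divides_coefs d (p * q).
Proof.
move=> dp i; rewrite coefM; apply: divides_sum => j; exact: divides_mulr.
Qed.

Lemma size_sub_monic p q : p \is monic -> q \is monic -> size p = size q ->
  (size (p - q)%R < size p)%N.
Proof.
move=> /monicP pm /monicP qm spq.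
have p0 : p != 0 by apply/eqP => p0; move: pm; rewrite p0 lead_coef0 => /esym/eqP;
  rewrite oner_eq0.
rewrite -(prednK (_ : 0 < size p)%N) ?size_poly_gt0 // ltnS; apply/leq_sizeP => j.
rewrite coefB leq_eqVlt => /predU1P[<-|lt].
  by rewrite -/(lead_coef p) spq -/(lead_coef q) pm qm subrr.
have le : (size p <= j)%N by rewrite -(prednK (_ : 0 < size p)%N) ?size_poly_gt0.
by rewrite !nth_default ?subrr // -spq.
Qed.

Lemma monicDl p q : p \is monic -> (size q < size p)%N ->
  p + q \is monic /\ size (p + q) = size p.
Proof. by move=> pm lt; rewrite size_polyDl // monicE lead_coefDl -?monicE. Qed.

(** Bezout's identity with a bound on degrees: E U is reduced modulo H. *)
Lemma bezout_bounded (G H U V E : {poly R}) : G \is monic -> H \is monic ->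
  U * G + V * H = 1 -> ((size E).+1 < size G + size H)%N ->
  exists X Y : {poly R}, [/\ (size X < size H)%N, (size Y < size G)%N & E = X * G + Y * H].
Proof.
move=> Gm Hm bez sE; pose X := Pdiv.Ring.rmodp (E * U) H.
pose Q := Pdiv.Ring.rdivp (E * U) H.
have QX : E * U = Q * H + X by exact: Pdiv.RingMonic.rdivp_eq.
have sX : (size X < size H)%N by rewrite Pdiv.Ring.ltn_rmodp monic_neq0.
have e : E = X * G + (Q * G + E * V) * H.
  rewrite -[LHS]mulr1 -bez mulrDr mulrA QX; ring.
exists X, (Q * G + E * V); split=> //.
set Y := Q * G + E * V in e *; have [->|Y0] := eqVneq Y 0.
  by rewrite size_poly0 size_poly_gt0 monic_neq0.
have YH : Y * H = E - X * G by rewrite [in RHS]e addrAC subrr add0r.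
have bound x y g h e' xg : (x < h -> e'.+1 < g + h -> 0 < g -> 0 < h ->
    xg <= (x + g).-1 -> (y + h).-1 <= maxn e' xg -> y < g)%N by lia.
have := size_polyD E (- (X * G)); rewrite -YH size_polyN (size_Mmonic Y0 Hm).
have := size_polyMleq X G.
have : (0 < size H)%N by rewrite size_poly_gt0 monic_neq0.
have : (0 < size G)%N by rewrite size_poly_gt0 monic_neq0.
exact: bound sX sE.
Qed.

(** If X G + Y H = d E, then X is d times the remainder of U E modulo H. *)
Lemma bezout_divides (G H U V X Y : {poly R}) d : H \is monic ->
  U * G + V * H = 1 -> (size X < size H)%N ->
  divides_coefs d (X * G + Y * H) -> divides_coefs d X.
Proof.
move=> Hm bez sX /divides_coefsP[E EE _].
have e : X = d *: (U * E) + (X * V - U * Y) * H.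
  rewrite scalerAr -EE -[LHS]mulr1 -bez; ring.
apply/divides_coefsP.
have : X = d *: Pdiv.Ring.rmodp (U * E) H.
  rewrite -{1}(Pdiv.Ring.rmodp_small sX) {1}e.
  by rewrite Pdiv.RingMonic.rmodpD // Pdiv.RingMonic.rmodp_mull // addr0
     Pdiv.RingMonic.rmodpZ.
by move=> XE; apply/divides_coefsP => i; rewrite XE coefZ; exists (Pdiv.Ring.rmodp (U * E) H)`_i;
   rewrite mulrC.
Qed.

End Coefficients.

Lemma lift_monic (R K : comNzRingType) (f : {rmorphism R -> K}) (g : {poly K}) :
  (forall y, exists x, f x = y) -> g \is monic ->
  exists2 G : {poly R}, G \is monic & map_poly f G = g.
Proof.
move=> /choice[lift liftK] gm.
have g0 : (0 < size g)%N by rewrite size_poly_gt0 monic_neq0.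
pose c i := if i == (size g).-1 then 1 else lift g`_i.
have sG : size (\poly_(i < size g) c i) = size g.
  by rewrite size_poly_eq // /c eqxx oner_neq0.
exists (\poly_(i < size g) c i).
  by apply/monicP; rewrite /lead_coef sG coef_poly prednK // leqnn /c eqxx.
apply/polyP => i; rewrite coef_map /= coef_poly; case: ltnP => ig; last first.
  by rewrite rmorph0 nth_default.
rewrite /c; case: eqP => [->|_]; last exact: liftK.
by rewrite rmorph1 -/(lead_coef g) (monicP gm).
Qed.

Lemma size_map_monic (R K : comNzRingType) (f : {rmorphism R -> K}) (G : {poly R}) :
  G \is monic -> size (map_poly f G) = size G.
Proof.
by move=> /monicP Gm; rewrite size_map_poly_id0 // Gm rmorph1 oner_neq0.
Qed.

Lemma map_resultant_monic (R K : comNzRingType) (f : {rmorphism R -> K})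
    (G H : {poly R}) : G \is monic -> H \is monic ->
  f (resultant G H) = resultant (map_poly f G) (map_poly f H).
Proof.
move=> Gm Hm; rewrite /resultant /Sylvester_mx !size_map_monic //.
rewrite -det_map_mx /= map_col_mx; congr (\det (col_mx _ _));
  by apply: map_lin1_mx => v; rewrite map_poly_rV rmorphM /= map_rVpoly.
Qed.

(** The resultant is a unit as soon as it is nonzero in the residue field. *)
Lemma bezout_lift (R K : comNzRingType) (P : {pred R}) (hP : local_with P)
    (f : {rmorphism R -> K}) :
  (forall y, exists x, f x = y) -> (forall x, (f x == 0) = (x \in P)) ->
  forall G H : {poly R}, G \is monic -> H \is monic ->
  (exists u v, u * map_poly f G + v * map_poly f H = 1) ->
  exists U V, U * G + V * H = 1.
Proof.
move=> fsurj f0 G H Gm Hm [u [v uv]].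
have const1 (A : {poly R}) : A \is monic -> (size A <= 1)%N -> A = 1.
  move=> /monicP Am sA; have A0 := size1_polyC sA.
  by rewrite A0 -[A`_0]lead_coefC -A0 Am.
have [/(const1 G Gm) ->|sG] := leqP (size G) 1.
  by exists 1, 0; rewrite mul0r addr0 mulr1.
have [/(const1 H Hm) ->|sH] := leqP (size H) 1.
  by exists 0, 1; rewrite mul0r add0r mulr1.
have [y y0|F [g g0]] := @field_of_inverses K.
  have [x xy] := fsurj y; have xP : x \notin P by rewrite -f0 xy.
  have [z zx] := local_unit hP xP.
  by exists (f z); rewrite -xy -rmorphM zx rmorph1.
have : coprimep (map_poly (g \o f) G) (map_poly (g \o f) H).
  apply/Bezout_coprimepP; exists (map_poly g u, map_poly g v) => /=.
  by rewrite !map_poly_comp -!rmorphM -rmorphD uv rmorph1 eqpxx.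
have res : (g \o f) (resultant G H) =
    resultant (map_poly (g \o f) G) (map_poly (g \o f) H).
  exact: map_resultant_monic.
rewrite coprimep_def => /eqP cop.
have resP : resultant G H \notin P.
  by rewrite -f0 -g0 -[g (f _)]/((g \o f) _) res resultant_eq0 cop.
have [e eE] := local_unit hP resP.
have [[U V] /= _ UV] := resultant_in_ideal sG sH.
exists (e *: U), (e *: V); rewrite -!scalerAl -scalerDr -UV.
by rewrite -mul_polyC -polyCM eE.
Qed.

Section Hensel.

Variables (R : comNzRingType) (P : {pred R}) (hP : local_with P).
Hypothesis hR : bounded_module_type R.

Variables (K : comNzRingType) (f : {rmorphism R -> K}).
Hypotheses (fsurj : forall y, exists x, f x = y)
  (f0 : forall x, (f x == 0) = (x \in P)).

Variables (F : {poly R}) (g h : {poly K}).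
Hypotheses (Fm : F \is monic) (gm : g \is monic) (hm : h \is monic).
Hypotheses (gh_coprime : exists u v, u * g + v * h = 1)
  (Fgh : map_poly f F = g * h).

Let total := divides_total_of_bounded hP hR.

Definition lifts (G H : {poly R}) : Prop :=
  [/\ G \is monic, H \is monic, map_poly f G = g & map_poly f H = h].

Lemma lifts_size G H : lifts G H -> size G = size g /\ size H = size h.
Proof. by case=> Gm Hm <- <-; rewrite !size_map_monic. Qed.

Lemma lifts_bezout G H G' H' : lifts G H -> lifts G' H' ->
  exists U V, U * G + V * H' = 1.
Proof.
case=> Gm _ Gg _ [_ Hm' _ Hh'].
by apply: (bezout_lift hP fsurj f0) => //; rewrite Gg Hh'.
Qed.

Lemma map_poly_scale_max d (A : {poly R}) : d \in P -> map_poly f (d *: A) = 0.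
Proof.
rewrite -f0 => /eqP fd0; apply/polyP => i.
by rewrite coef_map /= coefZ rmorphM /= fd0 mul0r coef0.
Qed.

Lemma common_divisor (Q : {pred R}) (A : {poly R}) :
  ideal Q -> (forall i, A`_i \in Q) -> exists2 d, d \in Q & divides_coefs d A.
Proof.
move=> Qid AQ.
suff [d dQ dA] : exists2 d, d \in Q & forall x, x \in (A : seq R) -> divides d x.
  exists d => // i; have [iA|Ai] := ltnP i (size A); first by apply/dA/mem_nth.
  by rewrite nth_default //; exact: divides0.
have : forall x, x \in (A : seq R) -> x \in Q by move=> x /(nthP 0)[i _ <-].
elim: (A : seq R) => [|a s IHs] sQ.
  by exists 0 => //; case: Qid.
have [x xs|d dQ ds] := IHs; first by apply: sQ; rewrite inE xs orbT.
have [ad|da] := total a d.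
  exists a => [|x]; first by apply: sQ; exact: mem_head.
  rewrite inE => /predU1P[->|/ds]; first exact: divides_refl.
  exact: divides_trans.
by exists d => // x; rewrite inE => /predU1P[->//|/ds].
Qed.

(** Newton's method: if the error is d (X G + Y H), then adding d Y to G and d X
    to H leaves an error of - d^2 X Y. *)
Lemma newton_step d G H : d \in P -> lifts G H -> divides_coefs d (F - G * H) ->
  exists G' H', lifts G' H' /\ divides_coefs (d * d) (F - G' * H').
Proof.
move=> dP GH; have [sG sH] := lifts_size GH.
have [U [V bez]] := lifts_bezout GH GH; case: GH => Gm Hm Gg Hh.
have GHm : G * H \is monic by rewrite monicMl.
have sF : size F = size (G * H).
  by rewrite -(size_map_monic f Fm) Fgh -Gg -Hh -rmorphM size_map_monic.
move=> /divides_coefsP[E EE sE].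
have sE' : ((size E).+1 < size G + size H)%N.
  have := size_sub_monic Fm GHm sF.
  rewrite sF (size_Mmonic (monic_neq0 Gm) Hm) => lt.
  have := leq_ltn_trans sE lt; clear; by case: (_ + _)%N.
have [X [Y [sX sY EXY]]] := bezout_bounded Gm Hm bez sE'.
have [|Gm' _] := monicDl (q := d *: Y) Gm; first exact: leq_ltn_trans (size_scale_leq _ _) sY.
have [|Hm' _] := monicDl (q := d *: X) Hm; first exact: leq_ltn_trans (size_scale_leq _ _) sX.
exists (G + d *: Y), (H + d *: X); split.
  by split=> //; rewrite rmorphD /= map_poly_scale_max // addr0.
have -> : F - (G + d *: Y) * (H + d *: X) = - ((d * d) *: (X * Y)).
  rewrite -!mul_polyC polyCM.
  transitivity (F - G * H - d%:P * (X * G + Y * H) - d%:P * d%:P * (X * Y)).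
    by ring.
  by rewrite EE EXY -mul_polyC; ring.
apply: divides_coefsN => i; rewrite coefZ; apply: divides_mulr.
exact: divides_refl.
Qed.

(** The difference of the two products is (H - H') G + (G - G') H', and Bezout's
    identity for G and H' separates these terms. *)
Lemma lifts_close d G H G' H' : lifts G H -> lifts G' H' ->
  divides_coefs d (F - G * H) -> divides_coefs d (F - G' * H') ->
  divides_coefs d (G - G') /\ divides_coefs d (H - H').
Proof.
move=> GH GH'; have [U [V bez]] := lifts_bezout GH GH'.
have [sG sH] := lifts_size GH; have [sG' sH'] := lifts_size GH'.
case: GH GH' => Gm Hm _ _ [Gm' Hm' _ _] dGH dGH'.
have dd : divides_coefs d ((H - H') * G + (G - G') * H').
  have -> : (H - H') * G + (G - G') * H' = (F - G' * H') - (F - G * H) by ring.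
  by apply: divides_coefsD => //; exact: divides_coefsN.
have sHH' : (size (H - H')%R < size H')%N.
  by rewrite sH' -sH; apply: size_sub_monic; rewrite // sH.
have sGG' : (size (G - G')%R < size G)%N.
  by apply: size_sub_monic; rewrite // sG.
split; last exact: bezout_divides bez _ dd.
apply: (bezout_divides Gm (U := V) (V := U) (G := H') (Y := H - H')) => //.
  by rewrite addrC.
by rewrite addrC.
Qed.

(** Let W be the set of the d dividing the error of some lift; it is closed
    under squaring, so that the intersection of the ideals d R is a prime
    ideal, nonmaximal if no lift is exact modulo I. Modulo it the lifts form a Cauchy
    family, whose limit is a lift with an error in the intersection. *)
Lemma hensel_factorization (I : {pred R}) : ideal I -> nonzero_ideal I ->
  exists G H, lifts G H /\ forall i, (F - G * H)`_i \in I.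
Proof.
move=> Iid [b0 b0I b0N]; apply: contrapT => noexact.
have [P0 PD PM] := local_ideal hP.
pose W d := d \in P /\ exists G H, lifts G H /\ divides_coefs d (F - G * H).
have WI d : W d -> d \notin I.
  move=> [_ [G [H [GH dGH]]]]; apply/negP => dI; apply: noexact.
  by exists G, H; split=> // i; exact: ideal_divides Iid (dGH i) dI.
have W0 : ~ W 0 by move/WI/negP; apply; case: Iid.
have Wsq d : W d -> W (d * d).
  move=> [dP [G [H [GH dGH]]]]; split; first exact: PM.
  exact: newton_step dGH.
pose B : {pred R} := [pred x | `[< forall d, W d -> divides d x >]].
have BP x : reflect (forall d, W d -> divides d x) (x \in B) by exact: asboolP.
have notB x : x \notin B -> exists2 d, W d & ~ divides d x.
  move=> xB; apply: contrapT => nd; move/BP: xB; apply=> d Wd.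
  by apply: contrapT => dx; apply: nd; exists d.
have Bid : ideal B.
  split; first by apply/BP => d _; exact: divides0.
    by move=> x y /BP xB /BP yB; apply/BP => d Wd; apply: dividesD; auto.
  by move=> x y /BP yB; apply/BP => d Wd; apply: divides_mull; auto.
have WB d : W d -> d \notin B.
  move=> Wd; apply/BP => /(_ _ (Wsq _ Wd))[r rE]; apply: W0.
  have d0 : d = 0 by apply: (local_cancel hP (PM r d Wd.1)); rewrite -mulrA.
  by rewrite -[X in W X]d0.
have Bsq x : x * x \in B -> x \in B.
  move=> /BP xxB; apply: contraT => /notB[d Wd dx].
  have [//|[y yE]] := total d x.
  have [yP|/(local_unit hP)[z zy]] := boolP (y \in P); last first.
    by case: dx; exists z; rewrite yE mulrA zy mul1r.
  have [w wE] := xxB _ (Wsq _ Wd).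
  have xx0 : x * x = 0.
    apply: (local_cancel hP (PM (w * y) y yP)).
    by rewrite {1}wE yE; ring.
  case: W0; have := Wsq _ Wd.
  have -> : d * d = y * y * (x * x) by rewrite yE; ring.
  by rewrite xx0 mulr0.
have [G0 G0m G0g] := lift_monic fsurj gm.
have [H0 H0m H0h] := lift_monic fsurj hm.
have [p Wp] : exists p, W p.
  have [i|d dP dE] := @common_divisor P (F - G0 * H0) (local_ideal hP).
    rewrite -f0; have <- : (map_poly f (F - G0 * H0))`_i = f (F - G0 * H0)`_i.
      by rewrite coef_map.
    by rewrite rmorphB rmorphM /= Fgh G0g H0h subrr coef0.
  by exists d; split=> //; exists G0, H0.
have pB := WB _ Wp; have pP := Wp.1.
have Bp x : x * p \in B -> x \in B.
  have [_ _ BM] := Bid; move=> xpB; have [[y yE]|[y yE]] := total p x.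
    by apply: Bsq; rewrite {1}yE -mulrA; apply: BM; rewrite mulrC.
  by move/negP: pB => []; apply: Bsq; rewrite {1}yE -mulrA; exact: BM.
have Bnz : nonzero_ideal B.
  exists b0 => //; apply/BP => d /WI dI.
  exact: (divides_of_notin hP hR Iid dI b0I).
have B1 : 1 \notin B.
  apply: contra pB; have [_ _ BM] := Bid.
  by move=> /(BM p); rewrite mulr1.
have approx x : x \notin B -> exists A : {poly R} * {poly R},
    lifts A.1 A.2 /\ divides_coefs x (F - A.1 * A.2).
  move=> /notB[d [_ [G [H [GH dGH]]]] dx]; exists (G, H); split=> //.
  by apply: divides_coefs_trans dGH; have [|//] := total d x.
have /choice[A AE] : forall x, exists A : {poly R} * {poly R}, x \notin B ->
    lifts A.1 A.2 /\ divides_coefs x (F - A.1 * A.2).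
  move=> x; have [xB|/approx[A AE]] := boolP (x \in B); first by exists (0, 0).
  by exists A.
have close x y : x \notin B -> y \notin B -> divides x y ->
    divides_coefs x ((A x).1 - (A y).1) /\ divides_coefs x ((A x).2 - (A y).2).
  move=> /AE[lx dx] /AE[ly dy] xy.
  by apply: lifts_close => //; exact: divides_coefs_trans dy.
have limit (C : R -> {poly R}) (c : {poly K}) :
    (forall x, x \notin B -> C x \is monic /\ map_poly f (C x) = c) ->
    (forall x y, x \notin B -> y \notin B -> divides x y ->
       divides_coefs x (C x - C y)) ->
    exists G : {poly R}, [/\ G \is monic, map_poly f G = c &
      forall x, x \notin B -> divides_coefs x (G - C x)].
  move=> Cm Ccl.
  have /choice[a aE] : forall i, exists a, forall x, x \notin B ->
      divides x (a - (C x)`_i).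
    move=> i; apply: (limit_exists hP hR Bid B1 pP Bp _ Bnz) => x y xB yB xy.
    by have := Ccl x y xB yB xy i; rewrite coefB.
  have sC x : x \notin B -> size (C x) = size c.
    by move=> /Cm[Cxm <-]; rewrite size_map_monic.
  have [Cpm Cpc] := Cm p pB.
  have c0 : (0 < size c)%N by rewrite -(sC p) // size_poly_gt0 monic_neq0.
  pose D := \poly_(i < (size c).-1) (a i - (C p)`_i).
  have sD : (size D < size (C p))%N.
    by rewrite sC // -(prednK c0) ltnS size_poly.
  have [Gm _] := monicDl Cpm sD.
  exists (C p + D); split=> //.
    have /divides_coefsP[D' -> _] : divides_coefs p D.
      by move=> i; rewrite coef_poly; case: ifP => _; [exact: aE | exact: divides0].
    by rewrite rmorphD /= Cpc map_poly_scale_max // addr0.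
  move=> x xB i; rewrite coefB coefD coef_poly; case: ltnP => ic.
    have -> : (C p)`_i + (a i - (C p)`_i) - (C x)`_i = a i - (C x)`_i by ring.
    exact: aE.
  rewrite addr0 -coefB nth_default; first exact: divides0.
  have [Cxm _] := Cm x xB; have := size_sub_monic Cpm Cxm.
  rewrite !sC // => /(_ erefl) lt.
  by apply: leq_trans ic; rewrite -ltnS prednK.
have [|x y xB yB xy|G [Gm Gg GE]] := limit (fun x => (A x).1) g.
- by move=> x /AE[[]].
- by have [] := close x y xB yB xy.
have [|x y xB yB xy|H [Hm Hh HE]] := limit (fun x => (A x).2) h.
- by move=> x /AE[[]].
- by have [] := close x y xB yB xy.
have GH : lifts G H by [].
have err x : x \notin B -> divides_coefs x (F - G * H).
  move=> xB; have [_ dx] := AE x xB.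
  have -> : F - G * H = (F - (A x).1 * (A x).2) - ((G - (A x).1) * H +
      (H - (A x).2) * (A x).1) by ring.
  apply: divides_coefsD => //; apply/divides_coefsN/divides_coefsD.
    by apply: divides_coefsM; exact: GE.
  by apply: divides_coefsM; exact: HE.
(* The common divisor d of the error is again in W, while it is divisible by
   everything outside B, in particular by d p. *)
pose Q : {pred R} := [pred y | `[< forall x, x \notin B -> divides x y >]].
have [||d /asboolP dQ dE] := @common_divisor Q (F - G * H).
- split; first by apply/asboolP => x _; exact: divides0.
    move=> x y /asboolP xQ /asboolP yQ; apply/asboolP => z zB.
    by apply: dividesD; auto.
  move=> x y /asboolP yQ; apply/asboolP => z zB.
  by apply: divides_mull; auto.
- by move=> i; apply/asboolP => x xB; exact: err.
have dP : d \in P by have [r ->] := dQ p pB; exact: PM.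
have Wd : W d by split=> //; exists G, H.
have dB := WB d Wd.
have [|r rE] := dQ (d * p); first by apply: contra dB; exact: Bp.
apply: W0; have d0 : d = 0.
  by apply: (local_cancel hP (PM r p pP)); rewrite {1}rE; ring.
by rewrite -[X in W X]d0.
Qed.

End Hensel.

Lemma almost_henselian_of_bounded (R : comNzRingType) (P : {pred R})
    (hP : local_with P) (hR : bounded_module_type R) : almost_henselian R.
Proof.
split=> [|I Inz]; first by exists P.
pose q : {rmorphism R -> {ideal_quot I}} := \pi_{ideal_quot I}.
have q0 x : (q x == 0) = (x \in I) by exact: ideal_quot_eq0.
have qsurj y : exists x, q x = y by exists (repr y); exact: reprK.
have Pid := local_ideal hP; have [P0 PD PM] := Pid.
have IP : {subset I <= P}.
  by apply: (proper_ideal_subset (local_unit hP) (ideal_idealr I)); rewrite idealr1.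
pose Q : {pred {ideal_quot I}} := [pred y | repr y \in P].
have QE x : (q x \in Q) = (x \in P).
  have e : repr (q x) - x \in I by rewrite -q0 rmorphB subr_eq0; apply/eqP; exact: reprK.
  rewrite inE; apply/idP/idP => xP.
    by rewrite -[x](subKr (repr (q x))); apply: idealB => //; exact: IP.
  by rewrite -(subrK x (repr (q x))); apply: PD => //; exact: IP.
have hQ : local_with Q.
  apply: local_with_nonunits; first split.
  - by rewrite -(rmorph0 q) QE.
  - move=> y z; have [a <-] := qsurj y; have [b <-] := qsurj z.
    by rewrite -rmorphD !QE; exact: PD.
  - move=> y z; have [a <-] := qsurj y; have [b <-] := qsurj z.
    by rewrite -rmorphM !QE; exact: PM.
  - by rewrite -(rmorph1 q) QE; case: hP => -[].
  - move=> y; have [a <-] := qsurj y; rewrite QE => /(local_unit hP)[b ba].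
    by exists (q b); rewrite -rmorphM ba rmorph1.
split; first by exists Q.
move=> m mmax F g h Fm gm hm cop Fgh.
pose r : {rmorphism {ideal_quot I} -> {ideal_quot m}} := \pi_{ideal_quot m}.
have r0 y : (r y == 0) = (y \in Q).
  by rewrite -(hQ.2 m mmax); exact: ideal_quot_eq0.
have rsurj y : exists x, r x = y by exists (repr y); exact: reprK.
have [F' Fm' FE] := lift_monic qsurj Fm.
have rq (A : {poly R}) : map_poly (r \o q) A = map_poly r (map_poly q A).
  exact: map_poly_comp.
have [|||G [H [[Gm Hm Gg Hh] GHI]]] := @hensel_factorization R P hP hR
  {ideal_quot m} (r \o q) _ _ F' g h Fm' gm hm cop _ I (ideal_idealr I) Inz.
- by move=> y; have [x <-] := rsurj y; have [a <-] := qsurj x; exists a.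
- by move=> x; rewrite -QE -r0.
- by rewrite rq FE.
exists (map_poly q G), (map_poly q H); split.
- exact: monic_map.
- exact: monic_map.
- rewrite -FE -rmorphM; apply/eqP; rewrite -subr_eq0 -rmorphB; apply/eqP/polyP => i.
  by rewrite coef_map coef0 /=; apply/eqP; rewrite q0.
- by rewrite -rq.
- by rewrite -rq.
Qed.

(** * Local rings of bounded module type *)

Unset Implicit Arguments.

Theorem theorem7 (R : comNzRingType) (P : {pred R})
    (hP : local_with P) (hR : bounded_module_type R) :
  [/\ valuation_ring R,
      (forall I : idealr R, nonzero_ideal I -> nonarchimedean P I ->
         ideal_complete {ideal_quot I}) /\
      (~ prime_idealr_closed (pred1 (0 : R)) ->
         nonarchimedean P (pred1 (0 : R)) -> ideal_complete R),
      almost_henselian R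
    & forall J : prime_idealr R, ~ maximal_ideal J ->
        almost_maximal (localization J)].
Proof.
split.
- exact: valuation_of_total (divides_total_of_bounded hP hR).
- split=> [I|]; first exact: quotient_complete hP hR I.
  exact: ring_complete hP hR.
- exact: almost_henselian_of_bounded hP hR.
- by move=> J; exact: almost_maximal_localization hP hR J.
Qed.
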